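(* The differential cubical forms on an elastic diffeological space $X$ are isomorphic to the de Rham forms on $X$, $$\Omega_{\mathrm{cub}}(X)\cong\Omega_{\mathrm{dR}}(X)$$ (in every degree $n\ge0$).
   Context: $\mathcal{E}\mathrm{ucl}$ is the category of open subsets of all $\mathbb{R}^k$, $k\ge1$, with smooth maps, with the Grothendieck topology of open covers. A diffeological space is a concrete sheaf on $\mathcal{E}\mathrm{ucl}$; $\mathcal{D}\mathrm{flg}$ is the category of diffeological spaces. A plot of $X$ is a morphism $p:U\to X$ with $U\in\mathcal{E}\mathrm{ucl}$; colimits and limits below are over the category of plots of $X$, colimits being taken in $\mathcal{D}\mathrm{flg}$. On $U\subset\mathbb{R}^k$ one has the usual tangent structure: $TU=U\times\mathbb{R}^k$, projection $\pi_U$, fiberwise addition $+_U:T_2U\to TU$ on the fiber product $T_2U=TU\times_UTU$, scalar multiplication $\kappa_U:\mathbb{R}\times TU\to TU$, and, writing elements of $T^2U$ as $(x,x_1,x_2,x_{12})$, the symmetric structure $\tau_U(x,x_1,x_2,x_{12})=(x,x_2,x_1,x_{12})$ and vertical lift $\lambda_U(x,x_1)=(x,0,0,x_1)$. The tangent functor on $\mathcal{D}\mathrm{flg}$ is the pointwise left Kan extension $TX=\mathrm{colim}_{U\to X}TU$. Elastic diffeological spaces form a full subcategory of $\mathcal{D}\mathrm{flg}$, containing $\mathcal{E}\mathrm{ucl}$, on which the left Kan extension yields a cartesian tangent structure with scalar $\mathbb{R}$-multiplication. Their key property is that fiber products of the tangent bundle and powers of the tangent functor commute with the colimit over plots: the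 natural maps $\mathrm{colim}_{U\to X}T_nU\to T_nX$ and $\mathrm{colim}_{U\to X}T^nU\to T^nX$ are isomorphisms (likewise for the composites such as $T_2T^{n-1}$), where $T_nX$ is the $n$-fold fiber product of $TX\to X$; and the structure maps $\pi_X,0_X,+_X,\kappa_X,\tau_X,\lambda_X$ are the maps induced on these colimits by those on plots. **Differential cubical forms.** $S_n$ acts on $T^nX$ by the homomorphism $\sigma\mapsto\sigma_X$ sending the transposition $(i,i+1)$ to $(T^{i-1}\tau T^{n-i-1})_X$. Let $\eta:T\mathbb{R}\cong\mathbb{R}\times\mathbb{R}\to\mathbb{R}$ be the projection to the fiber. For $n\ge1$ a differential cubical $n$-form on $X$ is a morphism $\omega:T^nX\to\mathbb{R}$ with $\omega\circ\sigma_X=(-1)^{|\sigma|}\omega$ for all $\sigma\in S_n$ and $\eta\circ T\omega\circ\lambda_{T^{n-1}X}=\omega$; $\Omega^n_{\mathrm{cub}}(X)$ is the set (real vector space) of these, and $\Omega^0_{\mathrm{cub}}(X)=\mathrm{Hom}(X,\mathbb{R})$. **De Rham forms.** $\Omega_{\mathrm{dR}}(X)=\lim_{U\to X}\Omega_{\mathrm{dR}}(U)$, where $\Omega_{\mathrm{dR}}(U)$ is the usual algebra of smooth differential forms on $U$: a de Rham form on $X$ is a family of forms $\omega_p\in\Omega_{\mathrm{dR}}(U)$, one for each plot $p:U\to X$, with $\omega_{p\circ f}=f^*\omega_p$ for all smooth $f:V\to U$. *)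

(* Defs.v *)
From HB Require Import structures.
From mathcomp Require Import all_boot all_order all_algebra all_fingroup.
From mathcomp Require Import all_classical all_reals all_analysis.
From Stdlib Require Import Relation_Operators.
Import Order.TTheory GRing.Theory Num.Theory.
Import numFieldNormedType.Exports.

Set Implicit Arguments.
Unset Strict Implicit.
Unset Printing Implicit Defensive.
Local Open Scope ring_scope.
Local Open Scope classical_set_scope.

Section Ck.
Variable R : realType.

(* On an open set A this is the usual C^k condition: f is C^(k+1) iff it is
   (Frechet) differentiable and all its directional derivatives are C^k. *)
Fixpoint Ck d (k : nat) (A : set 'rV[R]_d) (f : 'rV[R]_d -> R) : Prop :=
  if k is k'.+1 then
    (forall x, A x -> differentiable f x) /\ (forall v, Ck k' A ('D_v f))
  else forall x, A x -> {for x, continuous f}.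

Lemma near_eq_differentiable (V : normedModType R) (f g : V -> R) (x : V) :
  (\near x, f x = g x) -> differentiable f x -> differentiable g x.
Proof.
move=> fg df.
have -> : g = f + (g - f) by rewrite addrC subrK.
apply: differentiableD => //.
pose z := [the {linear V -> R} of \0 : V -> R].
have cz : continuous (z : V -> R) by exact: cst_continuous.
have H : (g - f) \o shift x = cst ((g - f) x) + z +o_ 0 id.
  apply/eqaddoP => e e0.
  have gfx : (g - f) x = 0.
    by apply/eqP; rewrite /GRing.add/= /GRing.opp/= subr_eq0; apply/eqP/esym;
       exact: (nbhs_singleton fg).
  have fg' : \forall h \near 0, f (h + x) = g (h + x).
    have := fg; rewrite (near_shift 0 x) /=.
    by apply: filterS => h; rewrite /= subr0.
  near=> h.
  have -> : (((g - f) \o shift x) - (cst ((g - f) x) + z)) h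
     = g (h + x) - f (h + x) - ((g - f) x + 0) by [].
  rewrite gfx addr0 subr0.
  have -> : f (h + x) = g (h + x) by near: h.
  by rewrite subrr normr0 mulr_ge0// ltW.
apply/diff_locallyP; have dz := diff_unique cz H.
split; rewrite ?dz //.
Unshelve. all: by end_near.
Qed.

Lemma Ck_ext d k (A : set 'rV[R]_d) (f g : 'rV[R]_d -> R) : open A ->
  {in A, f =1 g} -> Ck k A f -> Ck k A g.
Proof.
move=> oA; elim: k f g => [|k IH] f g fg /=.
  move=> H x Ax; have N : \near x, f x = g x.
    have : \near x, A x by exact: open_nbhs_nbhs.
    by apply: filterS => y Ay; apply: fg; rewrite inE.
  rewrite /prop_for /continuous_at -(nbhs_singleton N).
  exact: cvg_trans (near_eq_cvg N) (H x Ax).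
have N x : A x -> \near x, f x = g x.
  move=> Ax; have : \near x, A x by exact: open_nbhs_nbhs.
  by apply: filterS => y Ay; apply: fg; rewrite inE.
move=> [Hd HD]; split => [x Ax|v].
  exact: near_eq_differentiable (N x Ax) (Hd x Ax).
apply: IH (HD v) => x /set_mem Ax; exact/near_eq_derive/N.
Qed.

Lemma Ck_le d k (A : set 'rV[R]_d) f : Ck k.+1 A f -> Ck k A f.
Proof.
elim: k f => [|k IH] f; last first.
  by move=> [H1 H2]; split=> // v; apply: IH.
by move=> [H1 _] x Ax; exact/differentiable_continuous/H1.
Qed.

Lemma Ck_cst d k (A : set 'rV[R]_d) c : Ck k A (cst c).
Proof.
elim: k c => [|k IH] c /=; first by move=> x _; exact: cst_continuous.
split=> [x _|v]; first exact: differentiable_cst.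
rewrite [X in Ck _ _ X](_ : _ = cst 0) //.
by apply/funext => x; rewrite derive_cst.
Qed.

Lemma Ck_coord d k (A : set 'rV[R]_d) i : Ck k A (fun x => x 0 i).
Proof.
case: k => [|k] /=; first by move=> x _; exact: coord_continuous.
split=> [x _|v]; first exact: differentiable_coord.
rewrite [X in Ck _ _ X](_ : _ = cst (v 0 i)); first exact: Ck_cst.
apply/funext => x.
have := @derive_mx R 'rV[R]_d 1 d id x v (@derivable_id _ _ x v).
rewrite derive_id => /matrixP/(_ 0 i); rewrite mxE /= => ->.
by [].
Qed.

Lemma CkD d k (A : set 'rV[R]_d) f g : open A ->
  Ck k A f -> Ck k A g -> Ck k A (f \+ g).
Proof.
move=> oA; elim: k f g => [|k IH] f g.
  by move=> F G x Ax; exact: (cvgD (F x Ax) (G x Ax)).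
move=> [F1 F2] [G1 G2]; split=> [x Ax|v].
  by apply: differentiableD; [exact: F1|exact: G1].
apply: Ck_ext oA _ (IH _ _ (F2 v) (G2 v)) => x /set_mem Ax.
by rewrite [RHS]deriveD//; apply: diff_derivable; [exact: F1|exact: G1].
Qed.

Lemma CkM d k (A : set 'rV[R]_d) f g : open A ->
  Ck k A f -> Ck k A g -> Ck k A (f \* g).
Proof.
move=> oA; elim: k f g => [|k IH] f g.
  by move=> F G x Ax; exact: (cvgM (F x Ax) (G x Ax)).
move=> F G; have [F1 F2] := F; have [G1 G2] := G; split=> [x Ax|v].
  by apply: differentiableM; [exact: F1|exact: G1].
apply: Ck_ext oA _ (CkD oA (IH _ _ (Ck_le F) (G2 v)) (IH _ _ (Ck_le G) (F2 v))).
move=> x /set_mem Ax.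
by rewrite [RHS]deriveM//; apply: diff_derivable; [exact: F1|exact: G1].
Qed.

Lemma Ck_sum d k (A : set 'rV[R]_d) n (f : 'I_n -> 'rV[R]_d -> R) : open A ->
  (forall i, Ck k A (f i)) -> Ck k A (fun x => \sum_i f i x).
Proof.
move=> oA; elim: n f => [|n IH] f H.
  rewrite (_ : (fun _ => _) = cst 0); first exact: Ck_cst.
  by apply/funext => x; rewrite big_ord0.
rewrite (_ : (fun _ => _) =
   (fun x => \sum_(i < n) f (widen_ord (leqnSn n) i) x) \+ f ord_max).
  by apply: CkD => //; apply: IH.
by apply/funext => x; rewrite big_ord_recr.
Qed.

Definition row_of d m (F : 'I_m -> 'rV[R]_d -> R) : 'rV[R]_d -> 'rV[R]_m :=
  fun x => \row_j F j x.

Lemma row_ofE d m (F : 'I_m -> 'rV[R]_d -> R) :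
  row_of F = fun y => \sum_(j < m) F j y *: delta_mx 0 j.
Proof.
apply/funext => y; rewrite [RHS](_ : _ = \sum_(j < m) row_of F y 0 j *: delta_mx 0 j).
  exact: row_sum_delta.
by apply: eq_bigr => j _; rewrite mxE.
Qed.

Lemma continuous_row d m (F : 'I_m -> 'rV[R]_d -> R) x :
  (forall j, {for x, continuous (F j)}) -> {for x, continuous (row_of F)}.
Proof.
move=> H; rewrite row_ofE.
apply: (@cvg_big _ _ +%R 0 xpredT add_continuous _ (nbhs x) _
  (fun j y => F j y *: delta_mx 0 j) (fun j => F j x *: delta_mx 0 j)
  (nbhs_filter x)).
by move=> i _; apply: (continuousZr_tmp (H i)).
Qed.

Lemma differentiable_row d m (F : 'I_m -> 'rV[R]_d -> R) x :
  (forall j, differentiable (F j) x) -> differentiable (row_of F) x.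
Proof.
move=> H.
rewrite row_ofE.
have -> : (fun y => \sum_(j < m) F j y *: delta_mx 0 j) =
   \sum_(j < m) (fun y => F j y *: delta_mx 0 j : 'rV[R]_m).
  by rewrite fct_sumE.
by apply: differentiable_sum => j; apply: differentiableZl.
Qed.

Lemma derive_row d m (F : 'I_m -> 'rV[R]_d -> R) x v :
  (forall j, differentiable (F j) x) ->
  'D_v (row_of F) x = \row_j 'D_v (F j) x.
Proof.
move=> H; rewrite derive_mx; last exact/diff_derivable/differentiable_row.
apply/rowP => j; rewrite [LHS]mxE [RHS]mxE.
rewrite (_ : (fun t => row_of F t 0 j) = F j)//.
by apply/funext => y; rewrite mxE.
Qed.

Lemma derive_comp d m (f : 'rV[R]_d -> 'rV[R]_m) (g : 'rV[R]_m -> R) x v :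
  differentiable f x -> differentiable g (f x) ->
  'D_v (g \o f) x = 'D_('D_v f x) g (f x).
Proof.
move=> Hf Hg; rewrite !deriveE//; last exact: differentiable_comp.
by rewrite diff_comp.
Qed.

Lemma derive_linear d (g : 'rV[R]_d -> R) x : differentiable g x ->
  linear (fun v => 'D_v g x).
Proof. by move=> Hg a u v; rewrite !deriveE// linearP. Qed.

Lemma derive_sumE d (g : 'rV[R]_d -> R) x v : differentiable g x ->
  'D_v g x = \sum_j v 0 j * 'D_(delta_mx 0 j) g x.
Proof.
move=> Hg; rewrite deriveE// {1}(row_sum_delta v) linear_sum.
by apply: eq_bigr => j _; rewrite linearZ /= deriveE.
Qed.

Lemma Ck_comp d m k (A : set 'rV[R]_d) (B : set 'rV[R]_m)
    (F : 'I_m -> 'rV[R]_d -> R) (g : 'rV[R]_m -> R) :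
  open A -> open B -> (forall x, A x -> B (row_of F x)) ->
  (forall j, Ck k A (F j)) -> Ck k B g -> Ck k A (g \o row_of F).
Proof.
move=> oA oB AB; elim: k g => [|k IH] g /= HF Hg.
  move=> x Ax; apply: continuous_comp; last exact/Hg/AB.
  by apply: continuous_row => j; exact: HF.
have [G1 G2] := Hg; split=> [x Ax|v].
  apply: differentiable_comp; last exact/G1/AB.
  by apply: differentiable_row => j; apply: (HF j).1.
have HF' j : Ck k A (F j) by exact: Ck_le.
apply: (@Ck_ext _ _ _ (fun x => \sum_j ('D_v (F j) \*
     ('D_(delta_mx 0 j) g \o row_of F)) x)) => //.
  move=> x /set_mem Ax.
  have dF j : differentiable (F j) x by exact: (HF j).1.
  rewrite derive_comp//; [|exact: differentiable_row|exact/G1/AB].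
  rewrite derive_sumE; last exact/G1/AB.
  by apply: eq_bigr => j _; rewrite derive_row// mxE.
apply: Ck_sum => // j; apply: CkM => //; first exact: (HF j).2.
exact: IH.
Qed.
End Ck.

Section Eucl.
Variable R : realType.

Record eucl := Eucl {
  edim : nat;
  edim_gt0 : (0 < edim)%N;
  eset : set 'rV[R]_edim;
  eset_open : open eset }.

Arguments eset : clear implicits.

Coercion epts (U : eucl) : Type := set_type (eset U).

Definition ept (U : eucl) (x : 'rV[R]_(edim U)) (Ux : eset U x) : U :=
  SigSub (mem_set Ux).

Lemma esetP (U : eucl) (x : U) : eset U (\val x).
Proof. exact: set_valP. Qed.

(* Functions on an open set are total functions on the corresponding subtype;
   derivatives are taken of the extension by 0, which is harmless because
   the set is open. *)
Definition ext (U : eucl) (f : U -> R) : 'rV[R]_(edim U) -> R := 'valL_0 f.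
Arguments ext : simpl never.

Definition smooth (U : eucl) (f : U -> R) : Prop :=
  forall k, Ck k (eset U) (ext f).

Definition pd (U : eucl) (f : U -> R) (x : U) (v : 'rV[R]_(edim U)) : R :=
  'D_v (ext f) (\val x).

Definition coord (T : Type) (V : eucl) (f : T -> V) (j : 'I_(edim V)) : T -> R :=
  fun x => \val (f x) 0 j.

Record smap (U V : eucl) := Smap {
  sfun :> U -> V;
  smap_smooth : forall j, smooth (coord sfun j) }.

Definition dmap (U V : eucl) (f : U -> V) (x : U) (v : 'rV[R]_(edim U)) :
  'rV[R]_(edim V) := \row_j pd (coord f j) x v.

Implicit Types U V W : eucl.

Lemma smap_eq U V (f g : smap U V) : f =1 g -> f = g.
Proof.
case: f g => [f Hf] [g Hg] /= /funext fg; subst g.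
by congr Smap; exact: Prop_irrelevance.
Qed.

Lemma ext_val U (f : U -> R) (x : U) : ext f (\val x) = f x.
Proof. exact: (congr1 (@^~ x) (valLK 0 f)). Qed.

Lemma ext_eq U (f : U -> R) (g : 'rV[R]_(edim U) -> R) :
  (forall x : U, f x = g (\val x)) -> {in eset U, ext f =1 g}.
Proof. by move=> fg x Ux; rewrite -[x]/(\val (SigSub Ux : U)) ext_val fg. Qed.

Lemma smooth_of U (f : U -> R) (g : 'rV[R]_(edim U) -> R) :
  (forall x : U, f x = g (\val x)) -> (forall k, Ck k (eset U) g) -> smooth f.
Proof.
move=> fg Hg k; apply: Ck_ext (Hg k); first exact: eset_open.
by move=> x Ux; rewrite (ext_eq fg).
Qed.

Lemma pd_of U (f : U -> R) (g : 'rV[R]_(edim U) -> R) :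
  (forall x : U, f x = g (\val x)) -> forall x v, pd f x v = 'D_v g (\val x).
Proof.
move=> fg x v; apply: near_eq_derive.
have : \forall y \near \val x, eset U y by apply: open_nbhs_nbhs; split; [exact: eset_open|exact: esetP].
by apply: filterS => y Uy; apply: (ext_eq fg); rewrite inE.
Qed.

Lemma smooth_differentiable U (f : U -> R) (x : U) :
  smooth f -> differentiable (ext f) (\val x).
Proof. by move=> /(_ 1%N)[+ _]; apply; exact: esetP. Qed.

Lemma smooth_cst U (c : R) : smooth (fun _ : U => c).
Proof. by apply: (@smooth_of _ _ (cst c)) => // k; exact: Ck_cst. Qed.

Lemma pd_cst U (c : R) (x : U) v : pd (fun _ : U => c) x v = 0.
Proof. by rewrite (@pd_of _ _ (cst c)) // derive_cst. Qed.

Lemma smooth_proj U i : smooth (fun x : U => \val x 0 i).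
Proof. by apply: (@smooth_of _ _ (fun x => x 0 i)) => // k; exact: Ck_coord. Qed.

Lemma pd_proj U i (x : U) v : pd (fun x : U => \val x 0 i) x v = v 0 i.
Proof.
rewrite (@pd_of _ _ (fun x => x 0 i)) //.
have := @derive_mx R 'rV[R]_(edim U) 1 _ id (\val x) v (@derivable_id _ _ _ v).
by rewrite derive_id => /matrixP/(_ 0 i); rewrite [RHS]mxE => ->.
Qed.

Lemma smoothD U (f g : U -> R) : smooth f -> smooth g -> smooth (f \+ g).
Proof.
move=> Hf Hg; apply: (@smooth_of _ _ (ext f \+ ext g)).
  by move=> x /=; rewrite !ext_val.
by move=> k; apply: CkD => //; exact: eset_open.
Qed.

Lemma pdD U (f g : U -> R) x v : smooth f -> smooth g ->
  pd (f \+ g) x v = pd f x v + pd g x v.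
Proof.
move=> Hf Hg; rewrite (@pd_of _ _ (ext f \+ ext g)).
  by rewrite [LHS]deriveD//; exact/diff_derivable/smooth_differentiable.
by move=> y /=; rewrite !ext_val.
Qed.

Lemma smoothM U (f g : U -> R) : smooth f -> smooth g -> smooth (f \* g).
Proof.
move=> Hf Hg; apply: (@smooth_of _ _ (ext f \* ext g)).
  by move=> x /=; rewrite !ext_val.
by move=> k; apply: CkM => //; exact: eset_open.
Qed.

Lemma pdM U (f g : U -> R) x v : smooth f -> smooth g ->
  pd (f \* g) x v = f x * pd g x v + g x * pd f x v.
Proof.
move=> Hf Hg; rewrite (@pd_of _ _ (ext f \* ext g)).
  rewrite [LHS]deriveM; [|exact/diff_derivable/smooth_differentiable..].
  by rewrite !ext_val.
by move=> y /=; rewrite !ext_val.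
Qed.

Lemma smooth_sum U n (f : 'I_n -> U -> R) :
  (forall i, smooth (f i)) -> smooth (fun x => \sum_i f i x).
Proof.
move=> Hf; apply: (@smooth_of _ _ (fun x => \sum_i ext (f i) x)).
  by move=> x /=; apply: eq_bigr => i _; rewrite ext_val.
by move=> k; apply: Ck_sum => [|i]; [exact: eset_open|exact: Hf].
Qed.

Lemma pd_sum U n (f : 'I_n -> U -> R) x v : (forall i, smooth (f i)) ->
  pd (fun x => \sum_i f i x) x v = \sum_i pd (f i) x v.
Proof.
elim: n f => [|n IH] f Hf.
  rewrite big_ord0 (_ : (fun _ => _) = fun _ => 0) ?pd_cst//.
  by apply/funext => y; rewrite big_ord0.
rewrite big_ord_recr/= -IH// -pdD//; last exact: smooth_sum.
rewrite (_ : (fun y => \sum_(i < n.+1) f i y) =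
  (fun y => \sum_(i < n) f (widen_ord (leqnSn n) i) y) \+ f ord_max)//.
by apply/funext => y; rewrite big_ord_recr.
Qed.

Lemma pdZ U (f : U -> R) (c : R) x v : smooth f ->
  pd (fun y => c * f y) x v = c * pd f x v.
Proof.
move=> Hf; have := pdM x v (@smooth_cst U c) Hf.
by rewrite pd_cst mulr0 addr0.
Qed.

Lemma pd_linear U (f : U -> R) x : smooth f -> linear (pd f x).
Proof. by move=> Hf; apply: derive_linear; exact: smooth_differentiable. Qed.

Lemma pdE U (f : U -> R) x v : smooth f ->
  pd f x v = \sum_j v 0 j * pd f x (delta_mx 0 j).
Proof. by move=> Hf; apply: derive_sumE; exact: smooth_differentiable. Qed.

Lemma pd0 U (f : U -> R) x : pd f x 0 = 0.
Proof. exact: derive0. Qed.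

Lemma smooth_pd U (f : U -> R) v : smooth f -> smooth (fun x => pd f x v).
Proof.
move=> Hf; apply: (@smooth_of _ _ ('D_v (ext f))) => // k.
by have [_] := Hf k.+1; apply.
Qed.

Lemma row_of_coord U V (f : U -> V) (x : U) :
  row_of (fun j => ext (coord f j)) (\val x) = \val (f x).
Proof. by apply/rowP => j; rewrite mxE ext_val. Qed.

Lemma row_of_eset U V (f : U -> V) x : eset U x ->
  eset V (row_of (fun j => ext (coord f j)) x).
Proof.
move=> Ux; rewrite (_ : x = \val (ept Ux)) // row_of_coord; exact: esetP.
Qed.

Lemma smooth_comp U V (f : U -> V) (g : V -> R) :
  (forall j, smooth (coord f j)) -> smooth g -> smooth (g \o f).
Proof.
move=> Hf Hg.
apply: (@smooth_of _ _ (ext g \o row_of (fun j => ext (coord f j)))).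
  by move=> x; rewrite /= row_of_coord ext_val.
move=> k; apply: (@Ck_comp _ _ _ _ _ (eset V)); [exact: eset_open..| | |exact: Hg].
  exact: row_of_eset.
by move=> j; exact: Hf.
Qed.

Lemma pd_comp U V (f : smap U V) (g : V -> R) x v : smooth g ->
  pd (g \o f) x v = pd g (f x) (dmap f x v).
Proof.
move=> Hg.
rewrite (@pd_of _ _ (ext g \o row_of (fun j => ext (coord f j)))).
  rewrite derive_comp; first by rewrite derive_row ?row_of_coord// => j;
    exact/smooth_differentiable/smap_smooth.
  - by apply: differentiable_row => j; exact/smooth_differentiable/smap_smooth.
  - by rewrite row_of_coord; exact: smooth_differentiable.
by move=> y; rewrite /= row_of_coord ext_val.
Qed.

Lemma dmapE U V (f : smap U V) x v j :
  dmap f x v 0 j = pd (coord f j) x v.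
Proof. by rewrite mxE. Qed.

Lemma sid_subproof U j : smooth (coord (fun x : U => x) j).
Proof. exact: smooth_proj. Qed.
Definition sid U : smap U U := Smap (@sid_subproof U).

Lemma scomp_subproof U V W (g : smap V W) (f : smap U V) j :
  smooth (coord (g \o f) j).
Proof. exact: smooth_comp (smap_smooth f) (smap_smooth g j). Qed.
Definition scomp U V W (g : smap V W) (f : smap U V) : smap U W :=
  Smap (scomp_subproof g f).

Lemma scst_subproof U V (c : V) j : smooth (coord (fun _ : U => c) j).
Proof. exact: smooth_cst. Qed.
Definition scst U V (c : V) : smap U V := Smap (@scst_subproof U V c).

Lemma dmap_id U (x : U) v : dmap (sid U) x v = v.
Proof. by apply/rowP => j; rewrite dmapE; exact: pd_proj. Qed.

Lemma dmap_comp U V W (g : smap V W) (f : smap U V) x v :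
  dmap (scomp g f) x v = dmap g (f x) (dmap f x v).
Proof. by apply/rowP => j; rewrite !dmapE -(pd_comp _ _ _ (smap_smooth g j)). Qed.

Lemma dmap_linear U V (f : smap U V) x : linear (dmap f x).
Proof.
move=> a u v; apply/rowP => j; rewrite dmapE pd_linear; last exact: smap_smooth.
by rewrite [RHS]mxE [X in _ = X + _]mxE !dmapE.
Qed.

Definition restr (U : eucl) (A : set 'rV[R]_(edim U)) (oA : open A) : eucl :=
  Eucl (edim_gt0 U) (openI (@eset_open U) oA).

Definition rincl_fun (U : eucl) (A : set 'rV[R]_(edim U)) (oA : open A)
  (x : restr oA) : U := @ept U (\val x) (esetP x).1.

Lemma rincl_subproof U (A : set 'rV[R]_(edim U)) (oA : open A) j :
  smooth (coord (@rincl_fun U A oA) j).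
Proof. exact: smooth_proj. Qed.
Definition rincl U (A : set 'rV[R]_(edim U)) (oA : open A) : smap (restr oA) U :=
  Smap (@rincl_subproof U A oA).

Lemma smooth_local U (f : U -> R) :
  (forall x : U, exists (A : set 'rV[R]_(edim U)) (oA : open A),
    A (\val x) /\ smooth (f \o rincl oA)) -> smooth f.
Proof.
move=> H; suff K k g : (forall x : U, exists (A : set 'rV[R]_(edim U)),
    [/\ open A, A (\val x) & Ck k (eset U `&` A) g]) -> Ck k (eset U) g.
  move=> k; apply: K => x; have [A [oA [Ax HA]]] := H x.
  exists A; split=> //; apply: Ck_ext (HA k).
    exact: (@eset_open (restr oA)).
  move=> y /set_mem yA; rewrite (_ : y = \val (ept yA : restr oA)) //.
  by rewrite ext_val /= -ext_val.
elim: k g => [|k IH] g {H} H /=.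
  by move=> x Ux; have [A [oA Ax]] := H (ept Ux); apply.
split=> [x Ux|v]; first by have [A [oA Ax [+ _]]] := H (ept Ux); apply.
apply: IH => x; have [A [oA Ax [_ HA]]] := H x.
by exists A; split=> //; exact: HA.
Qed.

Lemma smap_preimage_open U V (f : smap U V) (A : set 'rV[R]_(edim V)) :
  open A -> open [set z | exists2 y : U, \val y = z & A (\val (f y))].
Proof.
move=> oA; rewrite openE => _ [y <- Afy].
pose F := row_of (fun j => ext (coord f j)).
have cF : {for \val y, continuous F}.
  by apply: continuous_row => j; exact: (@smap_smooth _ _ f j 0%N _ (esetP y)).
have NA : nbhs (F (\val y)) A.
  by rewrite /F row_of_coord nbhsE; exists A.
have NU : nbhs (\val y) (eset U).
  rewrite nbhsE; exists (eset U) => //; split; [exact: eset_open|exact: esetP].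
have NF : nbhs (\val y) (F @^-1` A) := cF _ NA.
change (nbhs (\val y)
  [set z | exists2 y : U, \val y = z & A (\val (f y))]).
apply: filterS (filterI NF NU) => z [Az Uz].
exists (ept Uz) => //; rewrite -row_of_coord; exact: Az.
Qed.

Arguments smap_preimage_open {U V} f {A} oA.

Definition restrict_smap_fun U V (f : smap U V) (A : set 'rV[R]_(edim V))
    (oA : open A) (x : restr (smap_preimage_open f oA)) : restr oA.
Proof.
refine (@ept (restr oA) (\val (f (rincl _ x))) _).
split; first exact: esetP.
have [y yx Ay] := (esetP x).2.
by rewrite (_ : rincl _ x = y)//; apply: val_inj; rewrite yx.
Defined.

Lemma restrict_smap_subproof U V (f : smap U V) (A : set 'rV[R]_(edim V))
    (oA : open A) j : smooth (coord (@restrict_smap_fun U V f A oA) j).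
Proof. exact: (smap_smooth (scomp f (rincl _)) j). Qed.
Definition restrict_smap U V (f : smap U V) (A : set 'rV[R]_(edim V))
    (oA : open A) : smap (restr (smap_preimage_open f oA)) (restr oA) :=
  Smap (@restrict_smap_subproof U V f A oA).

Lemma restrict_smapE U V (f : smap U V) A (oA : open A) x :
  rincl oA (restrict_smap f oA x) = f (rincl _ x).
Proof. exact: val_inj. Qed.

Lemma eprod_gt0 U m : (0 < edim U + m)%N.
Proof. by rewrite addn_gt0 edim_gt0. Qed.

Lemma eprod_open U m : open [set z : 'rV[R]_(edim U + m) | eset U (lsubmx z)].
Proof.
apply: open_comp (@eset_open U) => z _.
exact/differentiable_continuous/differentiable_lsubmx.
Qed.

(* U x R^m, as an open subset of R^(k+m). *)
Definition eprod U m : eucl := Eucl (eprod_gt0 U m) (@eprod_open U m).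

Definition ebase U m (z : eprod U m) : U := ept (esetP z : eset U (lsubmx (\val z))).

Definition efib U m (z : eprod U m) : 'rV[R]_m := rsubmx (\val z : 'rV_(_ + _)).

Lemma epair_subproof U m (x : U) (v : 'rV[R]_m) : eset (eprod U m) (row_mx (\val x) v).
Proof. by rewrite /= row_mxKl; exact: esetP. Qed.

Definition epair U m (x : U) (v : 'rV[R]_m) : eprod U m := ept (epair_subproof x v).

Lemma ebase_pair U m (x : U) (v : 'rV[R]_m) : ebase (epair x v) = x.
Proof. by apply: val_inj; rewrite /= row_mxKl. Qed.

Lemma efib_pair U m (x : U) (v : 'rV[R]_m) : efib (epair x v) = v.
Proof. by rewrite /efib /= row_mxKr. Qed.

Lemma epairE U m (z : eprod U m) : epair (ebase z) (efib z) = z.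
Proof. by apply: val_inj; rewrite /= hsubmxK. Qed.

Lemma smooth_efib U m i : smooth (fun z : eprod U m => efib z 0 i).
Proof.
rewrite (_ : (fun _ => _) = fun z : eprod U m => \val z 0 (rshift (edim U) i)).
  exact: smooth_proj.
by apply/funext => z; rewrite mxE.
Qed.

Lemma pd_efib U m i (z : eprod U m) v :
  pd (fun z : eprod U m => efib z 0 i) z v = v 0 (rshift (edim U) i).
Proof.
rewrite (_ : (fun _ => _) = fun z : eprod U m => \val z 0 (rshift (edim U) i)).
  exact: pd_proj.
by apply/funext => y; rewrite mxE.
Qed.

Lemma sbase_subproof U m j : smooth (coord (@ebase U m) j).
Proof.
rewrite (_ : coord _ j = fun z : eprod U m => \val z 0 (lshift m j)).
  exact: smooth_proj.
by apply/funext => z; rewrite /coord /= mxE.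
Qed.
Definition sbase U m : smap (eprod U m) U := Smap (@sbase_subproof U m).

Lemma dmap_sbase U m (z : eprod U m) v : dmap (sbase U m) z v = lsubmx v.
Proof.
apply/rowP => j; rewrite dmapE mxE.
rewrite (_ : coord _ j = fun z : eprod U m => \val z 0 (lshift m j)).
  exact: pd_proj.
by apply/funext => y; rewrite /coord /= mxE.
Qed.

Lemma spair_subproof W U m (f : smap W U) (g : W -> 'rV[R]_m) :
  (forall i, smooth (fun x => g x 0 i)) ->
  forall j, smooth (coord (fun x => epair (f x) (g x)) j).
Proof.
move=> Hg j; case: (split_ordP j) => i ->.
  rewrite (_ : coord _ _ = coord f i); first exact: smap_smooth.
  by apply/funext => x; rewrite /coord /= row_mxEl.
rewrite (_ : coord _ _ = fun x => g x 0 i) //.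
by apply/funext => x; rewrite /coord /= row_mxEr.
Qed.
Definition spair W U m (f : smap W U) (g : W -> 'rV[R]_m)
  (Hg : forall i, smooth (fun x => g x 0 i)) : smap W (eprod U m) :=
  Smap (spair_subproof f Hg).

Lemma smooth_pd_fib U m (h : U -> R) (L : {linear 'rV[R]_m -> 'rV[R]_(edim U)}) :
  smooth h -> smooth (fun z : eprod U m => pd h (ebase z) (L (efib z))).
Proof.
move=> Hh; rewrite (_ : (fun _ => _) = fun z : eprod U m =>
   \sum_i efib z 0 i * (pd h)^~ (L (delta_mx 0 i)) (sbase U m z)).
  apply: smooth_sum => i; apply: smoothM; first exact: smooth_efib.
  exact: (@smooth_comp _ _ (sbase U m) (fun y => pd h y (L (delta_mx 0 i)))
    (smap_smooth _) (smooth_pd _ Hh)).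
apply/funext => z.
pose H : {linear 'rV[R]_(edim U) -> R} :=
  HB.pack (pd h (ebase z)) (GRing.isLinear.Build _ _ _ _ _ (@pd_linear _ _ (ebase z) Hh)).
rewrite -[LHS]/(H (L (efib z))) [in LHS](row_sum_delta (efib z)) !linear_sum.
by apply: eq_bigr => i _; rewrite !linearZ.
Qed.

Record efunctor := EFunctor {
  eobj :> eucl -> eucl;
  emap : forall U V, smap U V -> smap (eobj U) (eobj V);
  emap_id : forall U, emap (sid U) = sid (eobj U);
  emap_comp : forall U V W (g : smap V W) (f : smap U V),
    emap (scomp g f) = scomp (emap g) (emap f) }.

Definition eid : efunctor :=
  @EFunctor (fun U => U) (fun U V f => f) (fun U => erefl) (fun U V W g f => erefl).

Lemma ecomp_id (G F : efunctor) U : emap G (emap F (sid U)) = sid (G (F U)).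
Proof. by rewrite !emap_id. Qed.

Lemma ecomp_comp (G F : efunctor) U V W (g : smap V W) (f : smap U V) :
  emap G (emap F (scomp g f)) =
  scomp (emap G (emap F g)) (emap G (emap F f)).
Proof. by rewrite !emap_comp. Qed.

Definition ecomp (G F : efunctor) : efunctor :=
  @EFunctor (fun U => G (F U)) (fun U V f => emap G (emap F f))
    (ecomp_id G F) (@ecomp_comp G F).

Definition etanmap_fun U V (f : smap U V) (z : eprod U (edim U)) :
  eprod V (edim V) := epair (f (ebase z)) (dmap f (ebase z) (efib z)).

Lemma etanmap_subproof U V (f : smap U V) j : smooth (coord (etanmap_fun f) j).
Proof.
apply: (@spair_subproof _ _ _ (scomp f (sbase _ _))
   (fun z => dmap f (ebase z) (efib z))) => i.
under eq_fun do rewrite dmapE.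
exact: (@smooth_pd_fib _ _ _ (@idfun 'rV[R]_(edim U))  (smap_smooth f i)).
Qed.
Definition etanmap U V (f : smap U V) := Smap (etanmap_subproof f).

Lemma etanmap_id U : etanmap (sid U) = sid (eprod U (edim U)).
Proof.
by apply: smap_eq => z; rewrite /= /etanmap_fun dmap_id epairE.
Qed.

Lemma etanmap_comp U V W (g : smap V W) (f : smap U V) :
  etanmap (scomp g f) = scomp (etanmap g) (etanmap f).
Proof.
apply: smap_eq => z.
by rewrite /= /etanmap_fun dmap_comp ebase_pair efib_pair.
Qed.

Definition etan : efunctor :=
  @EFunctor (fun U => eprod U (edim U)) etanmap etanmap_id etanmap_comp.

(* T_n U = U x (R^k)^n, the n vectors being the rows of a matrix. *)
Definition efvec U n (z : eprod U (n * edim U)) (i : 'I_n) : 'rV[R]_(edim U) :=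
  row i (vec_mx (efib z)).

Definition efibmap_fun n U V (f : smap U V) (z : eprod U (n * edim U)) :
  eprod V (n * edim V) :=
  epair (f (ebase z)) (mxvec (\matrix_(i < n) dmap f (ebase z) (efvec z i))).

Lemma efibmap_subproof n U V (f : smap U V) j : smooth (coord (@efibmap_fun n U V f) j).
Proof.
apply: (@spair_subproof _ _ _ (scomp f (sbase _ _))
   (fun z => mxvec (\matrix_(i < n) dmap f (ebase z) (efvec z i)))) => k.
case/mxvec_indexP: k => i k.
rewrite (_ : (fun _ => _) = fun z : eprod U (n * edim U) =>
    pd (coord f k) (ebase z) ((row i \o vec_mx) (efib z))).
  exact: (@smooth_pd_fib _ _ _ _ (smap_smooth f k)).
by apply/funext => z; rewrite mxvecE [LHS]mxE dmapE.
Qed.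
Definition efibmap n U V (f : smap U V) := Smap (@efibmap_subproof n U V f).

Lemma efvec_pair U n (x : U) (M : 'M[R]_(n, edim U)) i :
  efvec (epair x (mxvec M)) i = row i M.
Proof. by rewrite /efvec efib_pair mxvecK. Qed.

Lemma efibmap_id n U : efibmap n (sid U) = sid (eprod U (n * edim U)).
Proof.
apply: smap_eq => z; rewrite /= /efibmap_fun.
rewrite (_ : \matrix_i _ = vec_mx (efib z)) ?vec_mxK ?epairE//.
by apply/row_matrixP => i; rewrite rowK dmap_id.
Qed.

Lemma efibmap_comp n U V W (g : smap V W) (f : smap U V) :
  efibmap n (scomp g f) = scomp (efibmap n g) (efibmap n f).
Proof.
apply: smap_eq => z; rewrite /= /efibmap_fun.
rewrite ebase_pair; congr (epair _ (mxvec _)).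
by apply/row_matrixP => i; rewrite !rowK efvec_pair rowK dmap_comp.
Qed.

Definition etann (n : nat) : efunctor :=
  @EFunctor (fun U => eprod U (n * edim U)) (@efibmap n) (@efibmap_id n)
    (@efibmap_comp n).

(* An element (x, x1, x2, x12) of T^2 U has base point (x, x1) in TU and
   fiber component (x2, x12), so that the projection T^2 U -> TU is
   (x, x1, x2, x12) |-> (x, x1). *)
Definition eflip_fun U (z : etan (etan U)) : etan (etan U) :=
  let x := ebase (ebase z) in let x1 := efib (ebase z) in
  let x2 := lsubmx (efib z) in let x12 := rsubmx (efib z) in
  epair (epair x x2) (row_mx x1 x12).

Lemma smooth_efib2l U i : smooth (fun z : etan (etan U) =>
  (lsubmx (efib z : 'rV_(_ + _)) : 'rV_(edim U)) 0 i).
Proof. by under eq_fun do rewrite mxE; exact: smooth_efib. Qed.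
Lemma smooth_efib2r U i : smooth (fun z : etan (etan U) =>
  (rsubmx (efib z : 'rV_(_ + _)) : 'rV_(edim U)) 0 i).
Proof. by under eq_fun do rewrite mxE; exact: smooth_efib. Qed.

Lemma smooth_row_mx W m n (f : W -> 'rV[R]_m) (g : W -> 'rV[R]_n) :
  (forall i, smooth (fun x => f x 0 i)) -> (forall i, smooth (fun x => g x 0 i)) ->
  forall i, smooth (fun x => row_mx (f x) (g x) 0 i).
Proof.
move=> Hf Hg j; case: (split_ordP j) => i ->.
  by under eq_fun do rewrite row_mxEl; exact: Hf.
by under eq_fun do rewrite row_mxEr; exact: Hg.
Qed.

Lemma eflip_subproof U j : smooth (coord (@eflip_fun U) j).
Proof.
apply: (@spair_subproof _ _ _ (spair (scomp (sbase _ _) (sbase _ _)) (@smooth_efib2l U))).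
apply: smooth_row_mx => i; last exact: smooth_efib2r.
exact: (@smooth_comp _ _ (sbase _ _) (fun z : etan U => efib z 0 i)
   (smap_smooth _) (@smooth_efib _ _ i)).
Qed.
Definition eflip U : smap (etan (etan U)) (etan (etan U)) := Smap (@eflip_subproof U).

Definition elift_fun U (z : etan U) : etan (etan U) :=
  epair (epair (ebase z) 0) (row_mx 0 (efib z)).

Lemma smooth_0 W m (i : 'I_m) : smooth (fun _ : W => (0 : 'rV[R]_m) 0 i).
Proof. exact: smooth_cst. Qed.

Lemma elift_subproof U j : smooth (coord (@elift_fun U) j).
Proof.
apply: (@spair_subproof _ _ _ (spair (sbase _ _) (@smooth_0 _ _))).
by apply: smooth_row_mx => i; [exact: smooth_0|exact: smooth_efib].
Qed.
Definition elift U : smap (etan U) (etan (etan U)) := Smap (@elift_subproof U).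

Definition ezero U : smap U (etan U) := spair (sid U) (@smooth_0 U (edim U)).

Lemma ezero_nat U V (f : smap U V) x :
  etanmap f (ezero U x) = ezero V (f x).
Proof.
rewrite /= /etanmap_fun ebase_pair efib_pair; congr epair.
by apply/rowP => j; rewrite dmapE pd0 mxE.
Qed.

Lemma elift_nat U V (f : smap U V) z :
  emap etan (emap etan f) (elift U z) = elift V (emap etan f z).
Proof.
have E W1 W2 (g : smap W1 W2) y (w : 'rV_(edim W1)) :
    etanmap g (epair y w) = epair (g y) (dmap g y w).
  by rewrite /= /etanmap_fun ebase_pair efib_pair.
have d0 x : dmap f x 0 = 0 by apply/rowP => j; rewrite dmapE pd0 mxE.
transitivity (emap etan (emap etan f)
   (@epair (etan U) (edim (etan U)) (epair (ebase z) 0) (row_mx 0 (efib z)))).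
  by [].
rewrite [LHS]E [etanmap f (epair _ _)]E d0.
rewrite /= /elift_fun /etanmap_fun ebase_pair efib_pair; congr epair.
apply/rowP => j; rewrite mxE; case: (split_ordP j) => k ->.
  rewrite row_mxEl (_ : coord _ _ = coord f k \o sbase U (edim U)).
    by rewrite pd_comp ?dmap_sbase ?row_mxKl ?pd0 ?mxE//; exact: smap_smooth.
  by apply/funext => y; rewrite /coord /= row_mxEl.
rewrite row_mxEr dmapE.
have Hk := smap_smooth f k.
rewrite (_ : coord _ _ = fun y : etan U => \sum_i (efib y 0 i *
     ((pd (coord f k))^~ (delta_mx 0 i) \o sbase U (edim U)) y)); last first.
  by apply/funext => y; rewrite /coord /= row_mxEr dmapE pdE.
have S i : smooth ((pd (coord f k))^~ (delta_mx 0 i) \o sbase U (edim U)).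
  exact: (@smooth_comp _ _ (sbase U (edim U)) (fun y => pd (coord f k) y (delta_mx 0 i))
    (smap_smooth _) (smooth_pd _ Hk)).
rewrite pd_sum => [|i]; last by apply: smoothM => //; exact: smooth_efib.
rewrite pdE//; apply: eq_bigr => i _.
rewrite pdM//; last exact: smooth_efib.
by rewrite pd_efib row_mxEr efib_pair mxE mul0r add0r mulrC /= ebase_pair.
Qed.

End Eucl.

Arguments eset {R} e.
Arguments ext {R U} f : simpl never.
Arguments smap_preimage_open {R U V} f {A} oA.

Lemma sig_eq (A : Type) (P : A -> Prop) (a b : {x | P x}) :
  proj1_sig a = proj1_sig b -> a = b.
Proof. by case: a b => [a Pa] [b Pb] /= ab; exact: eq_exist. Qed.

Section Dflg.
Variable R : realType.
Local Notation eucl := (eucl R).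
Implicit Types U V W : eucl.

(* A concrete sheaf on Eucl, presented by its underlying set and the maps that
   are its sections: constant maps are plots, plots are closed under
   precomposition, and being a plot is local. By Yoneda, the plots U -> X are
   the morphisms from U to X. *)
Record dflg := Dflg {
  dcarrier :> Type;
  is_plot : forall U, (U -> dcarrier) -> Prop;
  is_plot_cst : forall U (c : dcarrier), is_plot (fun _ : U => c);
  is_plot_comp : forall U V (p : U -> dcarrier) (f : smap V U),
    is_plot p -> is_plot (p \o f);
  is_plot_local : forall U (p : U -> dcarrier),
    (forall x : U, exists (A : set 'rV[R]_(edim U)) (oA : open A),
       A (\val x) /\ is_plot (p \o rincl oA)) ->
    is_plot p }.

Implicit Types X Y Z : dflg.

Record hom X Y := Hom {
  hfun :> X -> Y;
  hom_plot : forall U (p : U -> X), is_plot p -> is_plot (hfun \o p) }.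

Lemma hom_eq X Y (f g : hom X Y) : f =1 g -> f = g.
Proof.
case: f g => [f Hf] [g Hg] /= /funext fg; subst g.
by congr Hom; exact: Prop_irrelevance.
Qed.

Lemma hid_subproof X U (p : U -> X) : is_plot p -> is_plot (id \o p).
Proof. by []. Qed.
Definition hid X : hom X X := Hom (@hid_subproof X).

Lemma hcomp_subproof X Y Z (g : hom Y Z) (f : hom X Y) U (p : U -> X) :
  is_plot p -> is_plot ((g \o f) \o p).
Proof. by move=> pp; apply: (hom_plot g); apply: hom_plot. Qed.
Definition hcomp X Y Z (g : hom Y Z) (f : hom X Y) : hom X Z :=
  Hom (@hcomp_subproof X Y Z g f).

Definition is_iso X Y (f : hom X Y) : Prop :=
  exists g : hom Y X, cancel f g /\ cancel g f.

Lemma Rline_local U (p : U -> R) :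
  (forall x : U, exists (A : set 'rV[R]_(edim U)) (oA : open A),
       A (\val x) /\ smooth (p \o rincl oA)) -> smooth p.
Proof. exact: smooth_local. Qed.

Definition Rline : dflg :=
  @Dflg R (@smooth R) (@smooth_cst R)
    (fun U V p f => smooth_comp (smap_smooth f)) Rline_local.

Record plots X U := Plot {
  pfun :> U -> X;
  plotP : is_plot pfun }.

Lemma plots_eq X U (p q : plots X U) : p =1 q -> p = q.
Proof.
case: p q => [p Hp] [q Hq] /= /funext pq; subst q.
by congr Plot; exact: Prop_irrelevance.
Qed.

Definition pcomp X U V (p : plots X U) (f : smap V U) : plots X V :=
  Plot (is_plot_comp f (plotP p)).

Definition hplot X Y U (g : hom X Y) (p : plots X U) : plots Y U :=
  Plot (hom_plot g (plotP p)).

Definition pcst X U (c : X) : plots X U := Plot (@is_plot_cst X U c).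

(* The colimit of U |-> F U over the category of plots of X, in Dflg: the set
   of pairs (plot p : U -> X, z in F U) modulo the equivalence relation
   generated by (p o f, z) ~ (p, F f z), with the final diffeology, i.e. the
   plots are the maps which locally factor smoothly through some F U. *)
Section Lan.
Variables (F : efunctor R) (X : dflg).

Record elt := Elt { eltU : eucl; eltp : plots X eltU; eltz : F eltU }.

Inductive glue : elt -> elt -> Prop :=
  Glue U V (p : plots X U) (f : smap V U) (z : F V) :
    glue (Elt (pcomp p f) z) (Elt p (emap F f z)).

Definition glued : elt -> elt -> Prop := clos_refl_sym_trans elt glue.

Definition lan_type : Type := {C : set elt | exists e, C = glued e}.

Definition lcls U (p : plots X U) (z : F U) : lan_type :=
  exist _ (glued (Elt p z)) (ex_intro _ (Elt p z) erefl).

Lemma lcls_eq U V (p : plots X U) (q : plots X V) z w :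
  glued (Elt p z) (Elt q w) -> lcls p z = lcls q w.
Proof.
move=> H; apply: sig_eq => /=; apply/seteqP; split=> e.
  by move=> He; apply: rst_trans He; exact: rst_sym.
by move=> He; apply: rst_trans He.
Qed.

Lemma lcls_comp U V (p : plots X U) (f : smap V U) (z : F V) :
  lcls (pcomp p f) z = lcls p (emap F f z).
Proof. by apply: lcls_eq; apply: rst_step; constructor. Qed.

Definition lrep (c : lan_type) : elt := projT1 (cid (projT2 c)).

Lemma lrepK (c : lan_type) : lcls (eltp (lrep c)) (eltz (lrep c)) = c.
Proof.
apply: sig_eq => /=; rewrite /lrep; case: cid => e /= ->.
by case: e.
Qed.

Lemma lcls_ind (P : lan_type -> Prop) :
  (forall U (p : plots X U) z, P (lcls p z)) -> forall c, P c.
Proof. by move=> H c; rewrite -(lrepK c). Qed.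

Definition lan_plot U (q : U -> lan_type) : Prop :=
  forall x : U, exists (A : set 'rV[R]_(edim U)) (oA : open A), A (\val x) /\
  exists V (p : plots X V) (h : smap (restr oA) (F V)),
    forall y, q (rincl oA y) = lcls p (h y).

Lemma lan_plot_cst U (c : lan_type) : lan_plot (fun _ : U => c).
Proof.
move=> x; exists setT, openT; split=> //.
elim/lcls_ind: c => V p z; exists V, p.
by exists (@scst _ (restr openT) _ z).
Qed.

Lemma lan_plot_comp U V (q : U -> lan_type) (f : smap V U) :
  lan_plot q -> lan_plot (q \o f).
Proof.
move=> H x; have [A [oA [Ax [W [p [h qE]]]]]] := H (f x).
exists _, (smap_preimage_open f oA); split; first by exists x.
exists W, p, (scomp h (restrict_smap f oA)) => y /=.
by rewrite -qE restrict_smapE.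
Qed.

Lemma lan_plot_local U (q : U -> lan_type) :
  (forall x : U, exists (A : set 'rV[R]_(edim U)) (oA : open A),
       A (\val x) /\ lan_plot (q \o rincl oA)) ->
  lan_plot q.
Proof.
move=> H x; have [A [oA [Ax Hq]]] := H x.
have Ux : eset (restr oA) (\val x) by split=> //; exact: esetP.
have [B [oB [Bx [W [p [h qE]]]]]] := Hq (ept Ux).
exists (A `&` B), (openI oA oB); split; first by split.
have HI (y : restr (openI oA oB)) : eset (restr (U := restr oA) oB) (\val y).
  by have [Uy [Ay By]] := esetP y; split.
have S j : smooth (coord (fun y : restr (openI oA oB) =>
     ept (HI y) : restr (U := restr oA) oB) j) by exact: smooth_proj.
exists W, p, (scomp h (Smap S)) => y /=.
by rewrite -qE /=; congr q; apply: val_inj.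
Qed.

Definition lan : dflg :=
  Dflg lan_plot_cst lan_plot_comp lan_plot_local.

Lemma lcls_plot U (p : plots X U) : is_plot (lcls p : F U -> lan).
Proof.
move=> z; exists setT, openT; split=> //.
by exists U, p, (rincl openT).
Qed.

Section LanRec.
Variables (Y : dflg) (phi : forall U, plots X U -> F U -> Y).
Hypothesis phi_comp : forall U V (p : plots X U) (f : smap V U) z,
  phi (pcomp p f) z = phi p (emap F f z).
Hypothesis phi_plot : forall U (p : plots X U), is_plot (phi p).

Definition lrec_fun (c : lan_type) : Y := phi (eltp (lrep c)) (eltz (lrep c)).

Lemma lrec_glued (e e' : elt) : glued e e' ->
  phi (eltp e) (eltz e) = phi (eltp e') (eltz e').
Proof.
by elim=> [_ _ [U V p f z]|//|_ _ _ ->|x y z _ -> _ ->] //=; exact: phi_comp.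
Qed.

Lemma lrec_funE U (p : plots X U) z : lrec_fun (lcls p z) = phi p z.
Proof.
rewrite /lrec_fun -[RHS]/(phi (eltp (Elt p z)) (eltz (Elt p z))).
apply: lrec_glued; apply: rst_sym.
have /(congr1 (@proj1_sig _ _)) := lrepK (lcls p z).
set e := lrep _ => /= E; change (glued (Elt p z) e).
by rewrite -[glued (Elt p z)]E; case: (e) => V q w; exact: rst_refl.
Qed.

Lemma lrec_subproof U (q : U -> lan) : is_plot q -> is_plot (lrec_fun \o q).
Proof.
move=> H; apply: is_plot_local => x.
have [A [oA [Ax [W [p [h qE]]]]]] := H x.
exists A, oA; split=> //.
rewrite (_ : _ \o _ = phi p \o h); first exact/is_plot_comp/phi_plot.
by apply/funext => y /=; rewrite qE lrec_funE.
Qed.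

Definition lrec : hom lan Y := Hom lrec_subproof.

Lemma lrecE U (p : plots X U) z : lrec (lcls p z) = phi p z.
Proof. exact: lrec_funE. Qed.

End LanRec.
End Lan.

Section LanMap.
Variables (F : efunctor R) (X Y : dflg) (g : hom X Y).

Lemma lmap_comp U V (p : plots X U) (f : smap V U) (z : F V) :
  lcls (hplot g (pcomp p f)) z = lcls (hplot g p) (emap F f z) :> lan F Y.
Proof. by rewrite -lcls_comp; congr lcls; exact: plots_eq. Qed.

Definition lmap : hom (lan F X) (lan F Y) :=
  lrec lmap_comp (fun U p => @lcls_plot F Y U (hplot g p)).

Lemma lmapE U (p : plots X U) (z : F U) : lmap (lcls p z) = lcls (hplot g p) z.
Proof. exact: (lrecE lmap_comp (fun U p => @lcls_plot F Y U (hplot g p))). Qed.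
End LanMap.

Notation T := (lan (etan R)).
Notation Tmap := (@lmap (etan R) _ _).

Section Tangent.
Variable X : dflg.

Lemma tproj_comp U V (p : plots X U) (f : smap V U) (z : etan R V) :
  (pcomp p f) (ebase z) = p (ebase (emap (etan R) f z)).
Proof. by rewrite /= ebase_pair. Qed.

Lemma tproj_plot U (p : plots X U) : is_plot (fun z : etan R U => p (ebase z)).
Proof. exact: (is_plot_comp (sbase _ _) (plotP p)). Qed.

Definition tproj : hom (T X) X := lrec tproj_comp tproj_plot.

Definition R1 : eucl := @Eucl R 1 (ltnSn 0) setT openT.
Definition R1_0 : R1 := @ept _ R1 0 I.

Definition tzero_fun (x : X) : T X := lcls (pcst R1 x) (ezero R1 R1_0).

Lemma tzero_funE U (p : plots X U) (u : U) :
  tzero_fun (p u) = lcls p (ezero U u).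
Proof.
have -> : ezero U u = emap (etan R) (scst R1 u) (ezero R1 R1_0).
  by rewrite [RHS]ezero_nat.
by rewrite -lcls_comp; congr lcls; apply: plots_eq.
Qed.

Lemma tzero_subproof U (p : U -> X) : is_plot p -> is_plot (tzero_fun \o p).
Proof.
move=> pp; pose P := Plot pp.
rewrite (_ : _ \o _ = (lcls P : _ -> T X) \o ezero U).
  exact/is_plot_comp/lcls_plot.
by apply/funext => u; exact: (tzero_funE P).
Qed.

Definition tzero : hom X (T X) := Hom tzero_subproof.

Definition tplot U (p : plots X U) : plots (T X) (etan R U) :=
  Plot (lcls_plot (F := etan R) p).

Lemma tplot_comp U V (p : plots X U) (f : smap V U) :
  tplot (pcomp p f) = pcomp (tplot p) (emap (etan R) f).
Proof. by apply: plots_eq => z; exact: lcls_comp. Qed.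

End Tangent.

Section Lift.
Variable X : dflg.

Lemma tlift_comp U V (p : plots X U) (f : smap V U) (z : etan R V) :
  tplot (tplot (pcomp p f)) (elift V z) =
  tplot (tplot p) (elift U (emap (etan R) f z)).
Proof. by rewrite -elift_nat 2!tplot_comp. Qed.

Definition tlift : hom (T X) (T (T X)) :=
  lrec tlift_comp
    (fun U p => is_plot_comp (elift U) (plotP (tplot (tplot p)))).

(* tau_X is the map induced on T^2 X by the maps tau_U on plots; tplot (tplot p)
   is T^2 p : T^2 U -> T^2 X. Such a map is unique because the maps T^2 p are
   jointly surjective, and it exists when T^2 X is the colimit of the T^2 U;
   the value of tflip when it does not exist is irrelevant. *)
Definition is_tflip (f : hom (T (T X)) (T (T X))) : Prop :=
  forall U (p : plots X U) (z : etan R (etan R U)),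
    f (tplot (tplot p) z) = tplot (tplot p) (eflip U z).

Definition tflip : hom (T (T X)) (T (T X)) :=
  if pselect (exists f, is_tflip f) is left ex then projT1 (cid ex) else hid _.

End Lift.

Section Fib.
Variables (n : nat) (X : dflg).

(* T_n X, the fiber product over X of n copies of TX; in particular T_0 X = X. *)
Definition fib_type : Type :=
  {a : X * ('I_n -> T X) | forall i, tproj X (a.2 i) = a.1}.

Definition fib_plot U (q : U -> fib_type) : Prop :=
  is_plot (fun u => (proj1_sig (q u)).1) /\
  forall i, is_plot (fun u => (proj1_sig (q u)).2 i).

Lemma fib_plot_cst U (c : fib_type) : fib_plot (fun _ : U => c).
Proof. by split=> [|i]; exact: is_plot_cst. Qed.

Lemma fib_plot_comp U V (q : U -> fib_type) (f : smap V U) :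
  fib_plot q -> fib_plot (q \o f).
Proof.
case=> H1 H2; split=> [|i]; first exact: (is_plot_comp f H1).
exact: (is_plot_comp f (H2 i)).
Qed.

Lemma fib_plot_local U (q : U -> fib_type) :
  (forall x : U, exists (A : set 'rV[R]_(edim U)) (oA : open A),
       A (\val x) /\ fib_plot (q \o rincl oA)) ->
  fib_plot q.
Proof.
move=> H; split=> [|i]; apply: is_plot_local => x;
  have [A [oA [Ax [H1 H2]]]] := H x; exists A, oA; split=> //.
exact: (H2 i).
Qed.

Definition fib : dflg := Dflg fib_plot_cst fib_plot_comp fib_plot_local.

Section FibPlot.
Variables (U : eucl) (p : plots X U).

Lemma fplot_subproof (z : etann R n U) (i : 'I_n) :
  tproj X (tplot p (epair (ebase z) (efvec z i))) = p (ebase z).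
Proof. by apply: etrans (lrecE _ _ p _) _; rewrite ebase_pair. Qed.

Definition fplot_fun (z : etann R n U) : fib :=
  exist _ (p (ebase z), fun i => tplot p (epair (ebase z) (efvec z i)))
    (fplot_subproof z).

Lemma efvec_smooth i k : smooth (fun z : etann R n U => efvec z i 0 k).
Proof.
under eq_fun do rewrite mxE mxE; exact: smooth_efib.
Qed.

Lemma fplot_plot : is_plot fplot_fun.
Proof.
split=> [|i]; first exact: (is_plot_comp (sbase _ _) (plotP p)).
exact: (is_plot_comp (spair (sbase _ _) (@efvec_smooth i)) (plotP (tplot p))).
Qed.
Definition fplot : plots fib (etann R n U) := Plot fplot_plot.
End FibPlot.

Lemma fplot_comp U V (p : plots X U) (f : smap V U) :
  fplot (pcomp p f) = pcomp (fplot p) (emap (etann R n) f).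
Proof.
apply: plots_eq => z; apply: sig_eq => /=; rewrite ebase_pair.
congr (_, _); apply/funext => i; rewrite lcls_comp; congr lcls.
by rewrite /= /etanmap_fun ebase_pair efib_pair efvec_pair rowK.
Qed.
End Fib.

(* A word such as [:: Fib 2; Tan; Tan] denotes the composite T_2 T T, both on
   Eucl (eword) and on Dflg (dword); pword w p is the plot w(p) : wU -> wX
   and word_comparison w X the natural map colim_{U -> X} wU -> wX. *)
Inductive tletter := Tan | Fib of nat.

Definition eletter (l : tletter) : efunctor R :=
  match l with Tan => etan R | Fib n => etann R n end.

Definition dletter (l : tletter) (X : dflg) : dflg :=
  match l with Tan => T X | Fib n => fib n X end.

Definition pletter (l : tletter) X U :
    plots X U -> plots (dletter l X) (eletter l U) :=
  match l with Tan => @tplot X U | Fib n => @fplot n X U end.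

Lemma pletter_comp l X U V (p : plots X U) (f : smap V U) :
  pletter l (pcomp p f) = pcomp (pletter l p) (emap (eletter l) f).
Proof. by case: l => [|n]; [exact: tplot_comp|exact: fplot_comp]. Qed.

Fixpoint eword (w : seq tletter) : efunctor R :=
  if w is l :: w' then ecomp (eletter l) (eword w') else eid R.

Fixpoint dword (w : seq tletter) (X : dflg) : dflg :=
  if w is l :: w' then dletter l (dword w' X) else X.

Fixpoint pword (w : seq tletter) X U (p : plots X U) :
    plots (dword w X) (eword w U) :=
  if w is l :: w' then pletter l (pword w' p) else p.

Lemma pword_comp w X U V (p : plots X U) (f : smap V U) :
  pword w (pcomp p f) = pcomp (pword w p) (emap (eword w) f).
Proof. by elim: w => //= l w ->; exact: pletter_comp. Qed.

Lemma pword_compE w X U V (p : plots X U) (f : smap V U) z :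
  pword w (pcomp p f) z = pword w p (emap (eword w) f z).
Proof. by rewrite pword_comp. Qed.

Definition word_comparison w X : hom (lan (eword w) X) (dword w X) :=
  lrec (@pword_compE w X) (fun U p => plotP (pword w p)).

Definition Tpow (n : nat) (X : dflg) : dflg := iter n (lan (etan R)) X.

(* The square with top tlift : TX -> T^2 X, left TX -> X, bottom
   (0, 0) : X -> T_2 X and right (pi_{TX}, T pi_X) : T^2 X -> T_2 X is a
   pullback in Dflg: universality of the vertical lift. *)
Definition vlift_universal X : Prop :=
  forall Z (g : hom Z (T (T X))) (h : hom Z X),
    (forall z, tproj (T X) (g z) = tzero X (h z)) ->
    (forall z, Tmap (tproj X) (g z) = tzero X (h z)) ->
    exists! k : hom Z (T X),
      (forall z, tlift X (k z) = g z) /\ (forall z, tproj X (k z) = h z).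

(* elastic_word makes the structure maps defined on plots descend to X, to the
   T_n X and to the iterated tangent spaces. The identities of a cartesian
   tangent structure with scalar multiplication then hold because they hold on
   plots, and T preserves the fiber products T_n. The universality of the
   vertical lift is not equational, hence is required separately. *)
Record elastic X : Prop := Elastic {
  elastic_word : forall w, is_iso (word_comparison w X);
  elastic_vlift : forall n, vlift_universal (Tpow n X) }.

(* tadj n i X = T^i tau T^(n-i-2) : T^n X -> T^n X, which is attached to the
   transposition of the 0-based indices i and i+1. Only i + 1 < n is used. *)
Fixpoint tadj (n i : nat) (X : dflg) : hom (Tpow n X) (Tpow n X) :=
  match n return hom (Tpow n X) (Tpow n X) with
  | 0 => hid _
  | m.+1 => match i with
    | 0 => match m return hom (Tpow m.+1 X) (Tpow m.+1 X) with
           | 0 => hid _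
           | k.+1 => tflip (Tpow k X)
           end
    | j.+1 => Tmap (tadj m j X)
    end
  end.

(* The graph of the homomorphism s |-> s_X from S_n: tperm_act s f says that
   f = s_X. Permutations compose from left to right in MathComp. *)
Inductive tperm_act (n : nat) (X : dflg) :
    'S_n -> hom (Tpow n X) (Tpow n X) -> Prop :=
| tperm_act1 : tperm_act 1%g (hid _)
| tperm_actM (i j : 'I_n) (s : 'S_n) (f : hom (Tpow n X) (Tpow n X)) :
    j = i.+1 :> nat -> tperm_act s f ->
    tperm_act (s * tperm i j)%g (hcomp (tadj n i X) f).

Lemma teta_comp U V (p : plots Rline U) (f : smap V U) (z : etan R V) :
  pd (pcomp p f) (ebase z) (efib z) =
  pd p (ebase (emap (etan R) f z)) (efib (emap (etan R) f z)).
Proof. by rewrite /= ebase_pair efib_pair -pd_comp//; exact: (plotP p). Qed.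

Lemma teta_plot U (p : plots Rline U) :
  @is_plot Rline _ (fun z : etan R U => pd p (ebase z) (efib z)).
Proof. exact: (@smooth_pd_fib _ _ _ _ (@idfun 'rV[R]_(edim U)) (plotP p)). Qed.

Definition teta : hom (T Rline) Rline := @lrec _ _ Rline _ teta_comp teta_plot.

(* For n = 0 a cubical form is just a morphism X -> R. *)
Definition cubical_axioms (n : nat) (X : dflg) : hom (Tpow n X) Rline -> Prop :=
  match n return hom (Tpow n X) Rline -> Prop with
  | 0 => fun _ => True
  | m.+1 => fun w =>
     (forall (s : 'S_m.+1) f, tperm_act s f ->
        forall a, w (f a) = (-1) ^+ odd_perm s * w a) /\
     (forall a, teta (Tmap w (tlift (Tpow m X) a)) = w a)
  end.

Definition is_cubical (n : nat) (X : dflg) (w : Tpow n X -> R) : Prop :=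
  exists2 h : hom (Tpow n X) Rline, hfun h = w & cubical_axioms h.

Lemma hlin_subproof X (a : R) (f g : hom X Rline) U (p : U -> X) :
  is_plot p -> @is_plot Rline U ((fun x => a * f x + g x) \o p).
Proof.
move=> pp; apply: smoothD; last exact: (hom_plot g pp).
by apply: smoothM; [exact: smooth_cst|exact: (hom_plot f pp)].
Qed.
Definition hlin X (a : R) (f g : hom X Rline) : hom X Rline :=
  Hom (@hlin_subproof X a f g).

Lemma tetaE X U (h : hom X Rline) (p : plots X U) (z : etan R U) :
  teta (Tmap h (lcls p z)) = pd (h \o p) (ebase z) (efib z).
Proof.
rewrite lmapE.
exact: (@lrecE (etan R) Rline Rline _ teta_comp teta_plot U (hplot h p) z).
Qed.

Lemma teta_lin X a (f g : hom X Rline) (z : T X) :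
  teta (Tmap (hlin a f g) z) = a * teta (Tmap f z) + teta (Tmap g z).
Proof.
elim/lcls_ind: z => U p z; rewrite !tetaE.
have Hf : smooth (f \o p) := hom_plot f (plotP p).
have Hg : smooth (g \o p) := hom_plot g (plotP p).
rewrite [LHS](@pdD _ _ (fun u => a * f (p u)) (g \o p))//; last first.
  by apply: smoothM => //; exact: smooth_cst.
by rewrite (@pdZ _ _ (f \o p)).
Qed.

Definition cubical_pred (n : nat) (X : dflg) : {pred Tpow n X -> R} :=
  [pred w | `[< @is_cubical n X w >]].

Lemma hcst_subproof X (c : R) U (p : U -> X) :
  is_plot p -> @is_plot Rline U ((fun=> c) \o p).
Proof. by move=> _; exact: smooth_cst. Qed.
Definition hcst X (c : R) : hom X Rline := Hom (@hcst_subproof X c).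

Lemma teta_cst X c (z : T X) : teta (Tmap (hcst X c) z) = 0.
Proof.
elim/lcls_ind: z => U p z; rewrite tetaE.
exact: (@pd_cst _ U c (ebase z) (efib z)).
Qed.

Lemma cubical_axioms0 n X : cubical_axioms (hcst (Tpow n X) 0).
Proof.
case: n => [//|n]; split=> [s f _ a|a]; first by rewrite /= mulr0.
by rewrite teta_cst.
Qed.

Lemma cubical_axioms_lin n X a (f g : hom (Tpow n X) Rline) :
  cubical_axioms f -> cubical_axioms g -> cubical_axioms (hlin a f g).
Proof.
case: n f g => [//|n] f g [F1 F2] [G1 G2]; split=> [s k H z|z].
  by rewrite /= (F1 _ _ H) (G1 _ _ H) mulrDr mulrCA.
by rewrite teta_lin F2 G2.
Qed.

Lemma cubical_submod n X : submod_closed (@cubical_pred n X).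
Proof.
split; first by apply/asboolP; exists (hcst _ 0) => //; exact: cubical_axioms0.
move=> a f g /asboolP[hf <- Hf] /asboolP[hg <- Hg]; apply/asboolP.
by exists (hlin a hf hg) => //; exact: cubical_axioms_lin.
Qed.

HB.instance Definition _ n X := GRing.isSubmodClosed.Build R (Tpow n X -> R)
  (@cubical_pred n X) (@cubical_submod n X).

Record Omega_cub (n : nat) (X : dflg) := OmegaCub {
  cub_fun :> Tpow n X -> R;
  cub_funP : cub_fun \in @cubical_pred n X }.

HB.instance Definition _ n X := [isSub for @cub_fun n X].
HB.instance Definition _ n X := [Choice of Omega_cub n X by <:].
HB.instance Definition _ n X := [SubChoice_isSubLmodule of Omega_cub n X by <:].

Record is_form n U (w : U -> ('I_n -> 'rV[R]_(edim U)) -> R) : Prop := IsForm {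
  form_smooth : forall v, smooth (w^~ v);
  form_linear : forall x v (i : 'I_n) a v1 v2,
    w x [eta v with i |-> a *: v1 + v2] =
    a * w x [eta v with i |-> v1] + w x [eta v with i |-> v2];
  form_alternating : forall x v (i j : 'I_n), i != j -> v i = v j -> w x v = 0 }.

(* A family (w_p) of n-forms, one for each plot p : U -> X, is encoded as a
   single function of (U, p, x, v), where x is a point of U and v is an
   n-tuple of tangent vectors at x. *)
Record dR_arg n X := DRArg {
  argU : eucl; argp : plots X argU; argx : argU; argv : 'I_n -> 'rV[R]_(edim argU) }.

Record is_dR n X (w : dR_arg n X -> R) : Prop := IsDR {
  dR_form : forall U (p : plots X U), is_form (fun x v => w (DRArg p x v));
  dR_pullback : forall U V (p : plots X U) (f : smap V U) x v,
    w (DRArg (pcomp p f) x v) = w (DRArg p (f x) (fun i => dmap f x (v i))) }.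

Definition dR_pred (n : nat) (X : dflg) : {pred dR_arg n X -> R} :=
  [pred w | `[< is_dR w >]].

Lemma dR_submod n X : submod_closed (@dR_pred n X).
Proof.
split.
  apply/asboolP; split=> // U p; split=> [v|x v i a v1 v2|//].
    exact: smooth_cst.
  by rewrite /= !(mulr0, addr0).
move=> a f g /asboolP[F1 F2] /asboolP[G1 G2]; apply/asboolP; split.
  move=> U p; have [F11 F12 F13] := F1 U p; have [G11 G12 G13] := G1 U p.
  split=> [v|x v i b v1 v2|x v i j ij vij].
  - apply: (@smoothD _ _ (fun x => a * f (DRArg p x v)) (fun x => g (DRArg p x v))) => //.
    by apply: smoothM; [exact: smooth_cst|exact: F11].
  - change (a * f (DRArg p x [eta v with i |-> b *: v1 + v2]) + g (DRArg p x [eta v with i |-> b *: v1 + v2]) =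
      b * (a * f (DRArg p x [eta v with i |-> v1]) + g (DRArg p x [eta v with i |-> v1])) +
      (a * f (DRArg p x [eta v with i |-> v2]) + g (DRArg p x [eta v with i |-> v2]))).
    rewrite F12 G12 !mulrDr addrACA; congr (_ + _ + _); exact: mulrCA.
  - change (a * f (DRArg p x v) + g (DRArg p x v) = 0).
    by rewrite (F13 _ _ _ _ ij vij) (G13 _ _ _ _ ij vij) mulr0 addr0.
move=> U V p h x v.
change (a * f (DRArg (pcomp p h) x v) + g (DRArg (pcomp p h) x v) =
  a * f (DRArg p (h x) (fun i => dmap h x (v i))) + g (DRArg p (h x) (fun i => dmap h x (v i)))).
by rewrite F2 G2.
Qed.

HB.instance Definition _ n X := GRing.isSubmodClosed.Build R (dR_arg n X -> R)
  (@dR_pred n X) (@dR_submod n X).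

Record Omega_dR (n : nat) (X : dflg) := OmegaDR {
  dR_fun :> dR_arg n X -> R;
  dR_funP : dR_fun \in @dR_pred n X }.

HB.instance Definition _ n X := [isSub for @dR_fun n X].
HB.instance Definition _ n X := [Choice of Omega_dR n X by <:].
HB.instance Definition _ n X := [SubChoice_isSubLmodule of Omega_dR n X by <:].

End Dflg.

(* Main.v *)
(* A cubical form w restricts along each plot p : U -> X to a smooth function F on
   T^n U which is antisymmetric and linear in each of its n vector bundle
   structures. In the coordinates (x, (v_S)) of T^n U, where S ranges over the
   nonempty subsets of {0, ..., n-1}, linearity isolates the contribution of a
   single v_S; if S contains two indices i and j, that contribution is fixed by
   the transposition of i and j, hence zero. So F (x, (v_S)) depends only on x and
   on the v_{i}, as an alternating multilinear form, and this is a de Rham form.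
   Conversely a de Rham form, evaluated on the v_{i}, is compatible with the plots,
   and elasticity (T^n X is the colimit of the T^n U) glues the resulting functions
   to a cubical form. The action of S_n on T^n X is given by the flips on plots
   because these are natural, which is the symmetry of second derivatives. *)
From HB Require Import structures.
Require Import Defs.
From mathcomp Require Import all_boot all_order all_algebra all_fingroup.
From mathcomp Require Import all_classical all_reals all_analysis.
Import Order.TTheory GRing.Theory Num.Theory.
Import numFieldNormedType.Exports.
(* Again, since mathcomp redefines coord and hom. *)
Import Defs.

Set Implicit Arguments.
Unset Strict Implicit.
Unset Printing Implicit Defensive.
Local Open Scope ring_scope.

(** * Symmetry of second derivatives *)

Section Schwarz.
Local Open Scope classical_set_scope.
Variables (R : realType) (d : nat).
Implicit Types (f : 'rV[R]_d -> R) (x u v : 'rV[R]_d).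

Lemma is_derive_line f x v (t : R) : differentiable f (x + t *: v) ->
  is_derive t (1 : R) (fun s : R => f (x + s *: v)) ('D_v f (x + t *: v)).
Proof.
move=> /diff_derivable df.
have E : (fun h : R => h^-1 *: (f (x + (h *: (1 : R) + t) *: v) - f (x + t *: v))) =
         (fun h : R => h^-1 *: (f (h *: v + (x + t *: v)) - f (x + t *: v))).
  apply/funext => h; congr (_ *: (f _ - _)).
  by rewrite scalerDl [h *: 1]mulr1 addrCA.
split; last by rewrite /derive /= E.
by rewrite /derivable /= E; exact: df.
Qed.

Lemma MVT_line (g : R -> R) (dg : R -> R) (r : R) : 0 < r ->
  (forall t, 0 <= t <= r -> is_derive t (1 : R) g (dg t)) ->
  exists2 c, 0 <= c <= r & g r - g 0 = r * dg c.
Proof.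
move=> r0 H; have [||c] := @MVT_segment R g dg 0 r (ltW r0).
- by move=> t; rewrite in_itv /= => /andP[a b]; apply: H; rewrite !ltW.
- apply: derivable_within_continuous => t; rewrite in_itv /= => tr.
  by have [] := H t tr.
- by rewrite in_itv /= subr0 => cr ->; exists c => //; rewrite mulrC.
Qed.

(** The mean value theorem applies twice: along [u] to the difference [g] of [f] on two parallel
    lines, then along [v] to ['D_u f]. *)
Lemma second_difference f x u v (r : R) : 0 < r ->
  (forall s t, 0 <= s <= r -> 0 <= t <= r ->
    differentiable f (x + s *: u + t *: v) /\
    differentiable ('D_u f) (x + s *: u + t *: v)) ->
  exists s t, [/\ 0 <= s <= r, 0 <= t <= r &
    f (x + r *: u + r *: v) - f (x + r *: u) - (f (x + r *: v) - f x) =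
    r * (r * 'D_v ('D_u f) (x + s *: u + t *: v))].
Proof.
move=> r0 H.
have rr : 0 <= r <= r by rewrite lexx ltW.
have oo : 0 <= (0 : R) <= r by rewrite lexx ltW.
pose g s := f (x + r *: v + s *: u) - f (x + s *: u).
pose dg s := 'D_u f (x + r *: v + s *: u) - 'D_u f (x + s *: u).
have [|s sr E] := @MVT_line g dg r r0.
  move=> s sr; have [d1 _] := H s r sr rr; have [d2 _] := H s 0 sr oo.
  apply: is_deriveB; apply: is_derive_line; first by rewrite addrAC.
  by move: d2; rewrite scale0r addr0.
have [|t tr F] := @MVT_line (fun t => 'D_u f (x + s *: u + t *: v))
    (fun t => 'D_v ('D_u f) (x + s *: u + t *: v)) r r0.
  by move=> t tr; apply: is_derive_line; have [] := H s t sr tr.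
exists s, t; split=> //; rewrite -F scale0r addr0.
by move: E; rewrite /g /dg scale0r !addr0 ![x + r *: v + _]addrAC.
Qed.

Lemma nbhs_square x u v (A : set 'rV[R]_d) : nbhs x A ->
  exists2 r : R, 0 < r & forall s t, 0 <= s <= r -> 0 <= t <= r ->
    A (x + s *: u + t *: v).
Proof.
move=> /nbhs_normP[e /= e0 eA].
have n0 : 0 < `|u| + `|v| + 1 by rewrite ltr_wpDl// addr_ge0.
(* The summand 1 keeps the denominator positive when [u] and [v] are both zero and makes the final
   inequality strict. *)
exists (e / (`|u| + `|v| + 1)); first exact: divr_gt0.
set r := _ / _ => s t /andP[s0 sr] /andP[t0 tr]; apply: eA => /=.
rewrite -addrA opprD addNKr normrN.
apply: (le_lt_trans (ler_normD _ _)); rewrite !normrZ (ger0_norm s0) (ger0_norm t0).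
apply: (@le_lt_trans _ _ (r * (`|u| + `|v|))).
  by rewrite mulrDr; apply: lerD; apply: ler_wpM2r.
by rewrite /r mulrAC ltr_pdivrMr// ltr_pM2l// ltrDl.
Qed.

Lemma dist_le_split (a b c e : R) :
  `|a - c| < e / 2 -> `|b - c| < e / 2 -> `|a - b| <= e.
Proof.
move=> ac bc; rewrite (le_trans (ler_distD c _ _))// [leRHS]splitr.
by rewrite lerD// ltW// distrC.
Qed.

(** The second difference over a small square is symmetric in [u] and [v], so the two mixed
    derivatives take a common value at points of the square; their continuity at [x] then makes them
    equal there. *)
Lemma Schwarz (A : set 'rV[R]_d) f x u v : open A -> Ck 2 A f -> A x ->
  'D_v ('D_u f) x = 'D_u ('D_v f) x.
Proof.
move=> oA [f1 f2] Ax; apply/eqP; rewrite -subr_eq0 -normr_le0.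
apply/ler_addgt0Pl => e e0; rewrite addr0.
have e2 : 0 < e / 2 by rewrite divr_gt0.
have near_D a b : \forall y \near x, `|'D_b ('D_a f) x - 'D_b ('D_a f) y| < e / 2.
  have [_ /(_ b) c] := f2 a.
  by move: (c x Ax) => /cvgr_dist_lt /(_ _ e2).
have nA : nbhs x A by exact: open_nbhs_nbhs.
have [r r0 H] := nbhs_square u v (filterI nA (filterI (near_D u v) (near_D v u))).
have [|s [t [sr tr E]]] := @second_difference f x u v r r0.
  by move=> s t sr tr; have [Ay _] := H s t sr tr; split; [exact: f1|exact: (f2 u).1].
have [|t' [s' [tr' sr' E']]] := @second_difference f x v u r r0.
  move=> t' s' tr' sr'; rewrite addrAC; have [Ay _] := H s' t' sr' tr'.
  by split; [exact: f1|exact: (f2 v).1].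
have DE : 'D_v ('D_u f) (x + s *: u + t *: v) = 'D_u ('D_v f) (x + t' *: v + s' *: u).
  apply/(mulfI (lt0r_neq0 r0))/(mulfI (lt0r_neq0 r0)).
  apply: etrans (esym E) (etrans _ E').
  by rewrite (addrAC x (r *: v)) !opprB addrACA [RHS]addrACA [- f _ - f _]addrC.
have [_ [B1 _]] := H s t sr tr; have [_ [_ B2]] := H s' t' sr' tr'.
rewrite (addrAC x (s' *: u)) -DE in B2.
exact: (dist_le_split B1 B2).
Qed.
End Schwarz.

(** * The flip and vertical vectors on Euclidean tangent bundles *)

Section EuclideanTangent.
Local Open Scope classical_set_scope.
Variable R : realType.
Implicit Types U V W : eucl R.

Lemma pd_sym U (g : U -> R) x u v : smooth g ->
  pd (fun y => pd g y u) x v = pd (fun y => pd g y v) x u.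
Proof.
move=> Hg.
have E a b : pd (fun y => pd g y a) x b = 'D_b ('D_a (ext g)) (\val x).
  exact: (@pd_of _ _ (fun y => pd g y a) ('D_a (ext g)) (fun=> erefl)).
rewrite !E; exact: (Schwarz _ _ (@eset_open _ U) (Hg 2%N) (esetP x)).
Qed.

(** The differentiated function is a sum of fiber coordinates times partial derivatives of [g]; the
    product rule gives a second-order term in the base direction and a first-order term in the fiber
    direction. *)
Lemma pd_tan U (g : U -> R) (z : etan R U) w : smooth g ->
  pd (fun y : etan R U => pd g (ebase y) (efib y)) z w =
  pd (fun y => pd g y (efib z)) (ebase z) (lsubmx w) + pd g (ebase z) (rsubmx w).
Proof.
move=> Hg.
have -> : (fun y : etan R U => pd g (ebase y) (efib y)) =
    fun y : etan R U => \sum_i (efib y 0 i *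
      ((pd g)^~ (delta_mx 0 i) \o sbase U (edim U)) y).
  by apply/funext => y; exact: pdE.
have Gi i : smooth ((pd g)^~ (delta_mx 0 i)) by exact: smooth_pd.
have S i : smooth ((pd g)^~ (delta_mx 0 i) \o sbase U (edim U)).
  exact: (smooth_comp (smap_smooth (sbase U (edim U))) (Gi i)).
rewrite pd_sum => [|i]; last first.
  by apply: smoothM; [exact: (@smooth_efib R U (edim U) i)|exact: S].
have -> : (fun y => pd g y (efib z)) =
    fun y => \sum_i (efib z 0 i * (pd g)^~ (delta_mx 0 i) y).
  by apply/funext => y; exact: pdE.
rewrite pd_sum => [|i]; last by apply: smoothM => //; exact: smooth_cst.
rewrite [pd g _ (rsubmx w)]pdE// -big_split; apply: eq_bigr => i _ /=.
rewrite (pdM _ _ (@smooth_efib R U (edim U) i) (S i)).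
by rewrite pd_efib pdZ// pd_comp// dmap_sbase [rsubmx w 0 i]mxE [X in _ = _ + X]mulrC.
Qed.

Lemma etan_pair U V (f : smap U V) x v :
  emap (etan R) f (epair x v) = epair (f x) (dmap f x v).
Proof. by rewrite /= /etanmap_fun ebase_pair efib_pair. Qed.

Lemma dmap_etan U V (f : smap U V) (z : etan R U) w :
  dmap (emap (etan R) f) z w =
  row_mx (dmap f (ebase z) (lsubmx w))
    (\row_j (pd (fun y => pd (coord f j) y (efib z)) (ebase z) (lsubmx w) +
             pd (coord f j) (ebase z) (rsubmx w))).
Proof.
apply/rowP => j; rewrite dmapE; case: (split_ordP j) => k ->.
  rewrite row_mxEl (_ : coord _ _ = coord f k \o sbase U (edim U)).
    by rewrite pd_comp ?dmap_sbase ?dmapE//; exact: smap_smooth.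
  by apply/funext => y; rewrite /coord /= row_mxEl.
rewrite row_mxEr mxE -pd_tan; last exact: smap_smooth.
congr (pd _ z w).
by apply/funext => y; rewrite /coord /= row_mxEr dmapE.
Qed.

Notation epair2 x x1 x2 x12 :=
  (@epair _ (etan R _) (edim (etan R _)) (epair x x1) (row_mx x2 x12)).

Lemma eflip_pair U (x : U) x1 x2 x12 :
  eflip U (epair2 x x1 x2 x12) = epair2 x x2 x1 x12.
Proof. by rewrite /= /eflip_fun !(ebase_pair, efib_pair) row_mxKl row_mxKr. Qed.

Lemma etan2_pair U V (f : smap U V) x x1 x2 x12 :
  emap (etan R) (emap (etan R) f) (epair2 x x1 x2 x12) =
  epair2 (f x) (dmap f x x1) (dmap f x x2)
    (\row_j (pd (fun y => pd (coord f j) y x1) x x2 +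
              pd (coord f j) x x12)).
Proof.
apply: etrans (etan_pair (emap (etan R) f) (epair x x1) (row_mx x2 x12)) _.
rewrite (etan_pair f x x1) (dmap_etan f (epair x x1)) ebase_pair efib_pair.
by rewrite row_mxKl row_mxKr.
Qed.

(** Only the last component of T^2 f mixes [x1] and [x2], through a second derivative of [f], which
    is symmetric. *)
Lemma eflip_nat U V (f : smap U V) z :
  emap (etan R) (emap (etan R) f) (eflip U z) =
  eflip V (emap (etan R) (emap (etan R) f) z).
Proof.
have [x [x1 [x2 [x12 ->]]]] : exists x x1 x2 x12, z = epair2 x x1 x2 x12.
  exists (ebase (ebase z)), (efib (ebase z)), (lsubmx (efib z)), (rsubmx (efib z)).
  by rewrite hsubmxK !epairE.
rewrite (eflip_pair x) (etan2_pair f x x2) (etan2_pair f x x1) (eflip_pair (f x)).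
apply: (congr1 (fun t => epair2 (f x) (dmap f x x2) (dmap f x x1) t)).
apply/rowP => j; rewrite [LHS]mxE [RHS]mxE.
by rewrite (pd_sym x x1 x2 (smap_smooth f j)).
Qed.

(* The curve t |-> (x, u + t v) of R1 realizes the vertical vector (0, v). *)
Lemma pd_vertical U m (F : eprod U m -> R) x v : smooth F ->
  linear (fun u : 'rV[R]_m => F (epair x u)) ->
  pd F (epair x 0) (row_mx 0 v) = F (epair x v).
Proof.
move=> SF LF.
have Sg i : smooth (fun t : R1 R => (\val t 0 ord0 *: v) 0 i).
  under eq_fun do rewrite mxE mulrC.
  by apply: (smoothM (@smooth_cst _ (R1 R) (v 0 i))); exact: smooth_proj.
pose c := spair (scst (R1 R) x) Sg.
pose e : 'rV[R]_(edim (R1 R)) := delta_mx 0 ord0.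
have c0 : c (R1_0 R) = epair x 0 by rewrite /= mxE scale0r.
have dc : dmap c (R1_0 R) e = row_mx 0 v.
  apply/rowP => j; rewrite dmapE; case: (split_ordP j) => k ->.
    rewrite row_mxEl mxE (_ : coord _ _ = fun=> \val x 0 k) ?pd_cst//.
    by apply/funext => t; rewrite /coord /= row_mxEl.
  rewrite row_mxEr (_ : coord _ _ = fun t : R1 R => v 0 k * \val t 0 ord0); last first.
    by apply/funext => t; rewrite /coord /= row_mxEr mxE mulrC.
  by rewrite pdZ ?pd_proj ?mxE ?eqxx ?mulr1//; exact: smooth_proj.
rewrite -c0 -dc -pd_comp//.
pose L : {linear 'rV[R]_m -> R} := HB.pack (fun u => F (epair x u))
  (GRing.isLinear.Build _ _ _ _ _ LF).
rewrite (_ : F \o c = fun t => F (epair x v) * \val t 0 ord0); last first.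
  by apply/funext => t; rewrite mulrC -[LHS]/(L (\val t 0 ord0 *: v)) linearZ.
by rewrite pdZ ?pd_proj ?mxE ?eqxx ?mulr1//; exact: smooth_proj.
Qed.

(** Serves for inclusions of open sets, base projections and permutations of components, all of them
    restrictions of linear maps. *)
Lemma dmap_of_linear U V (f : smap U V) (L : {linear 'rV[R]_(edim U) -> 'rV[R]_(edim V)}) :
  (forall x, \val (f x) = L (\val x)) -> forall x v, dmap f x v = L v.
Proof.
move=> fL x v; apply/rowP => j; rewrite dmapE.
have S i : smooth (fun y : U => \val y 0 i) by exact: smooth_proj.
rewrite (_ : coord f j = fun y : U => \sum_i L (delta_mx 0 i) 0 j * \val y 0 i).
  rewrite pd_sum => [|i]; last by apply: smoothM => //; exact: smooth_cst.
  rewrite [in RHS](row_sum_delta v) linear_sum summxE; apply: eq_bigr => i _.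
  by rewrite pdZ// pd_proj linearZ mxE mulrC.
apply/funext => y; rewrite /coord fL [in LHS](row_sum_delta (\val y)) linear_sum summxE.
by apply: eq_bigr => i _; rewrite linearZ mxE mulrC.
Qed.
End EuclideanTangent.

(** * Iterated tangent spaces of an elastic space as colimits *)

Section Colimit.
Local Open Scope classical_set_scope.
Variable R : realType.
Implicit Types (U V W : eucl R) (X Y : dflg R).

Lemma etan_rincl U (A : set 'rV[R]_(edim U)) (oA : open A) y v :
  emap (etan R) (rincl oA) (epair y v) = epair (rincl oA y) v.
Proof.
rewrite etan_pair; congr epair.
exact: (@dmap_of_linear _ _ _ (rincl oA) (@idfun 'rV[R]_(edim U))).
Qed.

Lemma etan2_rincl U (A : set 'rV[R]_(edim U)) (oA : open A) y v :
  emap (etan R) (emap (etan R) (rincl oA)) (epair y v) =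
  epair (emap (etan R) (rincl oA) y) v.
Proof.
rewrite etan_pair; congr epair.
apply: (@dmap_of_linear _ _ _ (emap (etan R) (rincl oA))
  (@idfun 'rV[R]_(edim (etan R U)))) => z.
by rewrite -(epairE z) etan_rincl.
Qed.

Lemma etan2_rincl_onto U (A : set 'rV[R]_(edim U)) (oA : open A)
    (z : etan R (etan R U)) : A (\val (ebase (ebase z))) ->
  exists z', emap (etan R) (emap (etan R) (rincl oA)) z' = z.
Proof.
move=> Az; pose x : restr oA :=
  @ept _ (restr oA) (\val (ebase (ebase z))) (conj (esetP _) Az).
exists (epair (epair x (efib (ebase z)) : etan R _) (efib z)).
rewrite etan2_rincl etan_rincl (_ : rincl oA x = ebase (ebase z)); last exact: val_inj.
by rewrite !epairE.
Qed.

Lemma is_iso_comp X Y Z (g : hom Y Z) (f : hom X Y) :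
  is_iso g -> is_iso f -> is_iso (hcomp g f).
Proof.
move=> [g' [gK g'K]] [f' [fK f'K]]; exists (hcomp f' g').
by split=> x /=; rewrite ?gK ?fK ?f'K ?g'K.
Qed.

Lemma lmap_iso (F : efunctor R) X Y (f : hom X Y) :
  is_iso f -> is_iso (lmap F f).
Proof.
move=> [g [fK gK]]; exists (lmap F g); split; elim/lcls_ind => U p z.
  by rewrite !lmapE; congr lcls; apply: plots_eq => u /=; rewrite fK.
by rewrite !lmapE; congr lcls; apply: plots_eq => u /=; rewrite gK.
Qed.

Notation E n := (eword R (nseq n Tan)).

Fixpoint Tplot n X U (p : plots X U) : plots (Tpow n X) (E n U) :=
  if n is m.+1 then tplot (Tplot m p) else p.

Lemma Tplot_comp n X U V (p : plots X U) (f : smap V U) :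
  Tplot n (pcomp p f) = pcomp (Tplot n p) (emap (E n) f).
Proof. by elim: n => //= n ->; exact: tplot_comp. Qed.

Lemma Tplot_compE n X U V (p : plots X U) (f : smap V U) z :
  Tplot n (pcomp p f) z = Tplot n p (emap (E n) f z).
Proof. by rewrite Tplot_comp. Qed.

(* dword (nseq n Tan) X and Tpow n X are equal, but not definitionally. *)
Lemma dword_Tpow n X : exists2 i : hom (dword (nseq n Tan) X) (Tpow n X),
  is_iso i & forall U (p : plots X U) z, i (pword (nseq n Tan) p z) = Tplot n p z.
Proof.
elim: n => [|n [i isoi iE]]; first by exists (hid X) => //; exists (hid X).
exists (lmap (etan R) i) => [|U p z]; first exact: lmap_iso.
apply: etrans (lmapE i (pword (nseq n Tan) p) z) _.
by congr lcls; apply: plots_eq => u; exact: iE.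
Qed.

Section Elastic.
Variable X : dflg R.
Hypothesis hX : elastic X.

(** Elasticity for the word of [n] letters [Tan]. The next three lemmas draw from it the joint
    surjectivity of the maps T^n p, the local factorization of plots through them, and the universal
    property. *)
Lemma lan_Tpow n : exists2 c : hom (lan (E n) X) (Tpow n X),
  is_iso c & forall U (p : plots X U) z, c (lcls p z) = Tplot n p z.
Proof.
have [i isoi iE] := dword_Tpow n X.
exists (hcomp i (word_comparison (nseq n Tan) X)) => [|U p z].
  by apply: is_iso_comp => //; exact: elastic_word.
rewrite -iE; apply: (congr1 i).
exact: (lrecE (@pword_compE _ (nseq n Tan) X) (fun U p => plotP (pword _ p))).
Qed.

Lemma Tplot_onto n (a : Tpow n X) : exists U (p : plots X U) z, Tplot n p z = a.
Proof.
have [c [g [cK gK]] cE] := lan_Tpow n; rewrite -(gK a).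
by elim/lcls_ind: (g a) => U p z; exists U, p, z; rewrite cE.
Qed.

Lemma Tplot_local n U (q : plots (Tpow n X) U) (x : U) :
  exists (A : set 'rV[R]_(edim U)) (oA : open A), A (\val x) /\
  exists V (p : plots X V) (h : smap (restr oA) (E n V)),
    pcomp q (rincl oA) = pcomp (Tplot n p) h.
Proof.
have [c [g [cK gK]] cE] := lan_Tpow n.
have [A [oA [Ax [V [p [h gqE]]]]]] := hom_plot g (plotP q) x.
exists A, oA; split=> //; exists V, p, h; apply: plots_eq => y /=.
by rewrite -cE -gqE /= gK.
Qed.

Lemma Tpow_rec n Y (phi : forall U, plots X U -> E n U -> Y) :
  (forall U V (p : plots X U) (f : smap V U) z,
     phi V (pcomp p f) z = phi U p (emap (E n) f z)) ->
  (forall U (p : plots X U), is_plot (phi U p)) ->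
  exists h : hom (Tpow n X) Y, forall U (p : plots X U) z, h (Tplot n p z) = phi U p z.
Proof.
move=> phiC phiP; have [c [g [cK gK]] cE] := lan_Tpow n.
exists (hcomp (lrec phiC phiP) g) => U p z.
by rewrite -cE; apply: etrans (congr1 _ (cK _)) (lrecE phiC phiP p z).
Qed.

(** The formula holds by construction on the plots T^k p. An arbitrary plot of T^k X factors locally
    through one of these, and naturality of the flip carries the formula over. *)
Lemma is_tflip_ex k : exists f, @is_tflip R (Tpow k X) f.
Proof.
have [|U p|f fE] := @Tpow_rec k.+2 (Tpow k.+2 X)
    (fun U p z => Tplot k.+2 p (eflip (E k U) z)).
- move=> U V p f z; rewrite Tplot_compE; congr (Tplot _ _ _).
  exact: eflip_nat.
- exact: (is_plot_comp (eflip _) (plotP (Tplot k.+2 p))).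
exists f => U q z.
have [A [oA [Az [V [p [h qE]]]]]] := Tplot_local q (ebase (ebase z)).
have [z' <-] := etan2_rincl_onto oA Az.
have C W (q' : plots (Tpow k X) W) W' (f' : smap W' W) y :
    tplot (tplot q') (emap (etan R) (emap (etan R) f') y) = tplot (tplot (pcomp q' f')) y.
  by rewrite !tplot_comp.
(* [C] moves a smooth map between the point and the plot: first the inclusion into the plot [q],
   then [h] back out to the point. *)
rewrite -eflip_nat !C qE -!C eflip_nat; exact: fE.
Qed.

Lemma tflipE k U (p : plots X U) z :
  tflip (Tpow k X) (Tplot k.+2 p z) = Tplot k.+2 p (eflip (E k U) z).
Proof.
have F : is_tflip (tflip (Tpow k X)).
  rewrite /tflip; case: pselect => [ex|[]]; last exact: is_tflip_ex.
  exact: projT2 (cid ex).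
exact: F.
Qed.

(** The counterpart of [tadj] on T^n U, by the same recursion. *)
Fixpoint eadj n i U : smap (E n U) (E n U) :=
  match n return smap (E n U) (E n U) with
  | 0 => sid _
  | m.+1 => match i with
    | 0 => match m return smap (E m.+1 U) (E m.+1 U) with
           | 0 => sid _
           | k.+1 => eflip (E k U)
           end
    | j.+1 => emap (etan R) (eadj m j U)
    end
  end.

Lemma tadjE n i U (p : plots X U) z :
  tadj n i X (Tplot n p z) = Tplot n p (eadj n i U z).
Proof.
elim: n i z => [//|n IH] [|i] z; first by case: n {IH} z => [//|n] z; exact: tflipE.
apply: etrans (lmapE (tadj n i X) (Tplot n p) z) _.
rewrite (_ : hplot _ _ = pcomp (Tplot n p) (eadj n i U)).
  exact: (@lcls_comp _ (etan R)).
by apply: plots_eq => y; exact: IH.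
Qed.
End Elastic.
End Colimit.

(** * Subsets of an index set, split at the first index *)

Section SetCons.
Variable n : nat.
Implicit Types (S : {set 'I_n.+1}) (A : {set 'I_n}).

Definition stail S : {set 'I_n} := [set i | lift ord0 i \in S].

(** With [stail], this identifies a subset of ['I_n.+1] with a bit and a subset of ['I_n], to match
    T^(n+1) U = T(T^n U): bit [false] for the base part, [true] for the fiber part. *)
Definition scons (b : bool) A : {set 'I_n.+1} :=
  [set i | if unlift ord0 i is Some j then j \in A else b].

Lemma scons_tail S : scons (ord0 \in S) (stail S) = S.
Proof.
by apply/setP => i; rewrite inE; case: unliftP => [j ->|->//]; rewrite inE.
Qed.

Lemma ord0_scons b A : (ord0 \in scons b A) = b.
Proof. by rewrite inE unlift_none. Qed.

Lemma stail_scons b A : stail (scons b A) = A.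
Proof. by apply/setP => i; rewrite !inE liftK. Qed.

Lemma stail0 : stail finset.set0 = finset.set0.
Proof. by apply/setP => i; rewrite !inE. Qed.

Lemma scons0 : scons false finset.set0 = finset.set0.
Proof. by apply/setP => i; rewrite !inE; case: unliftP => // j; rewrite inE. Qed.

Lemma stail1 : stail [set ord0] = finset.set0.
Proof. by apply/setP => i; rewrite !inE. Qed.

Lemma stail1_lift (i : 'I_n) : stail [set lift ord0 i] = [set i].
Proof. by apply/setP => j; rewrite !inE (inj_eq lift_inj). Qed.

End SetCons.

(** * Components of points of T^n U and the action of S_n on them *)

Section Components.
Variable R : realType.
Implicit Types (U V W : eucl R).
Notation E n := (eword R (nseq n Tan)).

(* A point of T^n U consists of a base point and of vectors v_S indexed by the
   nonempty subsets S of 'I_n; index 0 is the outermost application of T. *)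
Fixpoint tcomp n U : {set 'I_n} -> 'rV[R]_(edim (E n U)) -> 'rV[R]_(edim U) :=
  match n return {set 'I_n} -> 'rV[R]_(edim (E n U)) -> 'rV[R]_(edim U) with
  | 0 => fun _ w => w
  | m.+1 => fun S (w : 'rV[R]_(edim (E m U) + edim (E m U))) =>
      tcomp (stail S) (if ord0 \in S then rsubmx w else lsubmx w)
  end.

Lemma tcomp_linear n U (S : {set 'I_n}) : linear (@tcomp n U S).
Proof.
elim: n S => [//|n IH] S a u v /=; rewrite -IH; congr tcomp.
by case: ifP => _; apply/rowP => j; rewrite !mxE.
Qed.

HB.instance Definition _ n U S :=
  GRing.isLinear.Build R _ _ _ (@tcomp n U S) (@tcomp_linear n U S).

Fixpoint untcomp n U : ({set 'I_n} -> 'rV[R]_(edim U)) -> 'rV[R]_(edim (E n U)) :=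
  match n return ({set 'I_n} -> 'rV[R]_(edim U)) -> 'rV[R]_(edim (E n U)) with
  | 0 => fun a => a finset.set0
  | m.+1 => fun a =>
      row_mx (untcomp (a \o scons false)) (untcomp (a \o scons true))
  end.

Lemma untcompK n U (a : {set 'I_n} -> 'rV[R]_(edim U)) S : tcomp S (untcomp a) = a S.
Proof.
elim: n a S => [|n IH] a S /=; first by congr a; apply/setP => -[].
rewrite row_mxKl row_mxKr -[in RHS](scons_tail S).
by case: ifP => _; rewrite IH.
Qed.

Lemma tcomp_inj n U (w w' : 'rV[R]_(edim (E n U))) :
  (forall S, tcomp S w = tcomp S w') -> w = w'.
Proof.
elim: n w w' => [|n IH] w w' H; first exact: (H finset.set0).
rewrite -[w](hsubmxK (w : 'rV_(_ + _))) -[w'](hsubmxK (w' : 'rV_(_ + _))).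
congr row_mx; apply: IH => S.
  by have /= := H (scons false S); rewrite ord0_scons stail_scons.
by have /= := H (scons true S); rewrite ord0_scons stail_scons.
Qed.

Lemma untcomp_linear n U c (a b : {set 'I_n} -> 'rV[R]_(edim U)) :
  untcomp (fun S => c *: a S + b S) = c *: untcomp a + untcomp b.
Proof.
by apply: tcomp_inj => S; rewrite untcompK tcomp_linear !untcompK.
Qed.

(* The value of a at the empty set is ignored: there the component is x. *)
Fixpoint epoint n U (a : {set 'I_n} -> 'rV[R]_(edim U)) : smap U (E n U) :=
  match n return ({set 'I_n} -> 'rV[R]_(edim U)) -> smap U (E n U) with
  | 0 => fun=> sid U
  | m.+1 => fun a => spair (epoint (a \o scons false))
      (fun i => @smooth_cst R U (untcomp (a \o scons true) 0 i))
  end a.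

Lemma tcomp_epoint n U (a : {set 'I_n} -> 'rV[R]_(edim U)) x S :
  tcomp S (\val (epoint a x)) = if S == finset.set0 then \val x else a S.
Proof.
elim: n a S => [|n IH] a S; first by rewrite (_ : S = finset.set0) ?eqxx//; apply/setP => -[].
rewrite /= row_mxKl row_mxKr; case: ifP => S0.
  rewrite untcompK /= -[in a _]S0 scons_tail ifF//.
  by apply/eqP => S00; rewrite S00 inE in S0.
rewrite IH /= -{1}S0 scons_tail; congr (if _ then _ else _).
apply/eqP/eqP => [T|->]; last exact: stail0.
by rewrite -(scons_tail S) T S0 scons0.
Qed.

Fixpoint ebasen n U : smap (E n U) U :=
  if n is m.+1 then scomp (ebasen m U) (sbase _ _) else sid U.

Lemma ebasen_comp n U (z : E n U) : \val (ebasen n U z) = tcomp finset.set0 (\val z).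
Proof. by elim: n z => [//|n IH] z; rewrite /= IH stail0 inE. Qed.

Lemma ebasen_epoint n U (a : {set 'I_n} -> 'rV[R]_(edim U)) x :
  ebasen n U (epoint a x) = x.
Proof. by apply: val_inj; rewrite ebasen_comp tcomp_epoint eqxx. Qed.

Lemma dmap_ebasen n U (z : E n U) w : dmap (ebasen n U) z w = tcomp finset.set0 w.
Proof. exact/dmap_of_linear/ebasen_comp. Qed.

Lemma ebasen_nat n U V (f : smap U V) z :
  ebasen n V (emap (E n) f z) = f (ebasen n U z).
Proof. by elim: n z => [//|n IH] z /=; rewrite ebase_pair IH. Qed.

(** The component at {0} is the image of the fiber vector under the derivative of [ebasen], so the
    chain rule and [ebasen_nat] apply; the other singletons lie in the base part, by induction. *)
Lemma tcomp1_nat n U V (f : smap U V) (z : E n U) i :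
  tcomp [set i] (\val (emap (E n) f z)) =
  dmap f (ebasen n U z) (tcomp [set i] (\val z)).
Proof.
elim: n z i => [|n IH] z i; first by case: i.
rewrite /= row_mxKl row_mxKr; case: (unliftP ord0 i) => [j ->|->].
  by rewrite stail1_lift inE (negbTE (neq_lift _ _)) IH.
rewrite stail1 inE eqxx -(dmap_ebasen (emap (E n) f (ebase z))).
rewrite -(dmap_ebasen (ebase z)) -2!dmap_comp.
have -> // : scomp (ebasen n V) (emap (E n) f) = scomp f (ebasen n U).
by apply: smap_eq => y; exact: ebasen_nat.
Qed.

(** The linear extension of the action [eact] to the ambient vector space. *)
Definition permL n U (s : 'S_n) (w : 'rV[R]_(edim (E n U))) : 'rV[R]_(edim (E n U)) :=
  untcomp (fun S => tcomp (s @^-1: S) w).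

Lemma permL_linear n U s : linear (@permL n U s).
Proof.
move=> c u v; rewrite -untcomp_linear; congr untcomp; apply/funext => S.
exact: tcomp_linear.
Qed.

HB.instance Definition _ n U s :=
  GRing.isLinear.Build R _ _ _ (@permL n U s) (@permL_linear n U s).

Lemma stail_tperm n (i j : 'I_n) (S : {set 'I_n.+1}) :
  stail (tperm (lift ord0 i) (lift ord0 j) @^-1: S) = tperm i j @^-1: stail S.
Proof.
apply/setP => k; rewrite !inE; congr (_ \in S).
by case: tpermP => [/lift_inj->|/lift_inj->|ki kj]; rewrite ?tpermL ?tpermR//;
   rewrite tpermD//; apply/eqP => kE; [apply: ki|apply: kj]; rewrite kE.
Qed.

Lemma tcomp_eadj n m (i j : 'I_n) U (z : E n U) S : i = m :> nat -> j = m.+1 :> nat ->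
  tcomp S (\val (eadj n m U z)) = tcomp (tperm i j @^-1: S) (\val z).
Proof.
elim: n m i j z S => [|n IH] m i j z S; first by case: i.
case: (unliftP ord0 i) => [i' ->|->] im jm; last first.
  have {im} m0 : m = 0%N by rewrite -im.
  rewrite {}m0 {m} in jm *.
  case: n IH i j z S jm => [|n] IH i j z S jm; first by case: j jm => -[].
  have -> : j = lift ord0 ord0 by apply: val_inj.
  rewrite /= !row_mxKl !row_mxKr.
  rewrite !inE !tpermL !tpermR.
  have -> : stail (stail (tperm ord0 (lift ord0 ord0) @^-1: S)) =
            stail (stail S).
    by apply/setP => k; rewrite !inE tpermD.
  by case: (ord0 \in S); case: (lift ord0 ord0 \in S); rewrite ?row_mxKl ?row_mxKr.
case: (unliftP ord0 j) jm => [j' ->|->//] jm.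
case: m im jm => [//|m] [im] [jm].
(* By induction [eadj n m U] is the restriction of a linear map, so its derivative, which acts on
   the fiber part, permutes components in the same way. *)
have vE y : \val (eadj n m U y) = permL (tperm i' j') (\val y).
  by apply: tcomp_inj => A; rewrite untcompK; exact: IH.
rewrite /= row_mxKl row_mxKr stail_tperm inE tpermD//.
case: ifP => _; last exact: IH.
by rewrite (dmap_of_linear vE) untcompK.
Qed.

(** Going through [epoint] keeps the base point, and with it membership in T^n U. *)
Definition eact n U (s : 'S_n) (z : E n U) : E n U :=
  epoint (fun S => tcomp (s @^-1: S) (\val z)) (ebasen n U z).

Lemma tcomp_eact n U s (z : E n U) S :
  tcomp S (\val (eact s z)) = tcomp (s @^-1: S) (\val z).
Proof.
by rewrite tcomp_epoint; case: eqP => // ->; rewrite preimset0 ebasen_comp.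
Qed.

Lemma tcomp_val_inj n U (z z' : E n U) :
  (forall S, tcomp S (\val z) = tcomp S (\val z')) -> z = z'.
Proof. by move=> H; apply/val_inj/tcomp_inj. Qed.

Lemma eactM n U s t (z : E n U) : eact (s * t)%g z = eact t (eact s z).
Proof.
apply: tcomp_val_inj => S; rewrite !tcomp_eact; congr tcomp.
by apply/setP => i; rewrite !inE permM.
Qed.

Lemma eact_eadj n (i j : 'I_n) U (z : E n U) : j = i.+1 :> nat ->
  eadj n i U z = eact (tperm i j) z.
Proof. by move=> ij; apply: tcomp_val_inj => S; rewrite tcomp_eact (tcomp_eadj _ _ erefl ij). Qed.

Lemma epointE n U (z : E n U) :
  epoint (fun S => tcomp S (\val z)) (ebasen n U z) = z.
Proof.
by apply: tcomp_val_inj => S; rewrite tcomp_epoint; case: eqP => // ->; rewrite ebasen_comp.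
Qed.
End Components.

(** * Multilinear antisymmetric functions of families indexed by subsets *)

Section Singletons.
Variables (R : realType) (V : lmodType R) (I : finType).
Implicit Types (a : {set I} -> V) (S B : {set I}) (v : I -> V).

(** The sum has at most one term; off the singletons it is empty, hence zero. *)
Definition on_singletons v S : V := \sum_(i | S == [set i]) v i.

Lemma on_singletons1 v i : on_singletons v [set i] = v i.
Proof.
by rewrite /on_singletons (big_pred1 i)// => j; rewrite (inj_eq set1_inj) eq_sym.
Qed.

Lemma on_singletons0 v S : (forall i, S != [set i]) -> on_singletons v S = 0.
Proof. by move=> H; rewrite /on_singletons big1// => i; rewrite (negbTE (H i)). Qed.

Variable f : ({set I} -> V) -> R.
Hypothesis f_ext : forall a a', (forall S, S != finset.set0 -> a S = a' S) -> f a = f a'.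
(** Linearity in the [i]-th bundle structure: all components with [i \in S] vary together, the
    others stay fixed. *)
Hypothesis f_lin : forall i c a a1 a2,
  (forall S, i \in S -> a S = c *: a1 S + a2 S) ->
  (forall S, i \notin S -> a1 S = a S /\ a2 S = a S) ->
  f a = c * f a1 + f a2.
Hypothesis f_alt : forall i j a, i != j ->
  f (fun S => a (tperm i j @^-1: S)) = - f a.

Lemma multilinear_eq0 i a : (forall S, i \in S -> a S = 0) -> f a = 0.
Proof.
move=> a0; have H : f a = 1 * f a + f a.
  by apply: (@f_lin i) => // S iS; rewrite (a0 _ iS) scaler0 addr0.
by apply: (addrI (f a)); rewrite addr0 {3}H mul1r.
Qed.

(* The part of a supported on B and on the sets avoiding i and j is fixed by
   the transposition of i and j, hence f vanishes on it. *)
Lemma multilinear_drop i j B a : i != j -> i \in B -> j \in B ->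
  f a = f (fun S => if S == B then 0 else a S).
Proof.
move=> ij iB jB.
(* [a2] keeps [B] alone among the sets containing [i], and [a22] keeps [B] alone among those
   containing [i] or [j]; they are split off by linearity in [i], then in [j]. *)
pose a2 S := if (i \in S) && (S != B) then 0 else a S.
pose a22 S := if ((i \in S) || (j \in S)) && (S != B) then 0 else a S.
have -> : f a = 1 * f (fun S => if S == B then 0 else a S) + f a2.
  apply: (@f_lin i) => S iS; rewrite /a2.
    by rewrite iS scale1r; case: eqP => //= _; rewrite ?add0r ?addr0.
  by rewrite (negbTE iS) /=; case: eqP => // SB; rewrite SB iB in iS.
have -> : f a2 = 1 * f (fun S => if S == B then 0 else a2 S) + f a22.
  apply: (@f_lin j) => S jS; rewrite /a22.
    by rewrite jS orbT scale1r /= /a2; case: eqP => _ /=; rewrite ?andbF ?add0r ?addr0.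
  rewrite /a2 (negbTE jS) orbF; split=> //.
  by case: eqP => // SB; rewrite SB jB in jS.
have -> : f (fun S => if S == B then 0 else a2 S) = 0.
  by apply: (@multilinear_eq0 i) => S iS; rewrite /a2 iS /=; case: eqP.
rewrite mulr0 add0r mul1r.
suff /eqP : f a22 = - f a22.
  by rewrite -addr_eq0 -mulr2n mulrn_eq0 /= => /eqP->; rewrite addr0.
rewrite -(f_alt a22 ij); congr f; apply/funext => S; rewrite /a22.
rewrite !inE tpermL tpermR [(j \in S) || _]orbC.
have tB : tperm i j @^-1: B = B.
  by apply/setP => k; rewrite !inE; case: tpermP => // ->; rewrite iB jB.
have SB : (tperm i j @^-1: S == B) = (S == B).
  apply/eqP/eqP => [tS|->//]; rewrite -tB -tS.
  by apply/setP => k; rewrite !inE tpermK.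
rewrite SB; case: eqP => [->|_]; first by rewrite tB andbF.
rewrite andbT; case: ifP => // /norP[iS jS]; congr a.
apply/setP => k; rewrite !inE; case: tpermP => // ->.
  by rewrite (negbTE iS) (negbTE jS).
by rewrite (negbTE iS) (negbTE jS).
Qed.

(** Sets with at least two elements are dropped one at a time, and [f] ignores the empty set; only
    singletons remain. *)
Lemma multilinear_singletons a : f a = f (on_singletons (fun i => a [set i])).
Proof.
have K (s : seq {set I}) : all (fun S => 1 < #|S|)%N s ->
    f a = f (fun S => if S \in s then 0 else a S).
  elim: s => [_|B s IH /= /andP[/card_gt1P[i [j [iB jB ij]]] /IH ->]].
    by congr f; apply/funext => S.
  rewrite (multilinear_drop _ ij iB jB); congr f; apply/funext => S.
  by rewrite inE; case: eqP.
rewrite (K (enum [set S : {set I} | (1 < #|S|)%N])); last first.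
  by apply/allP => S; rewrite mem_enum inE.
apply: f_ext => S S0; rewrite mem_enum inE; case: ltnP => S1.
  by rewrite on_singletons0// => i; apply: contraTneq S1 => ->; rewrite cards1.
have /cards1P[i ->] : #|S| == 1%N by rewrite eqn_leq S1 card_gt0.
by rewrite on_singletons1.
Qed.
End Singletons.

(** * From cubical forms on U to differential forms *)

Section Forms.
Variable R : realType.
Implicit Types (U V W : eucl R).
Notation E n := (eword R (nseq n Tan)).

(** Linearity is asked in the outermost bundle structure, of index 0; antisymmetry transports it to
    the other indices. *)
Definition fiber_linear n U : (E n U -> R) -> Prop :=
  match n return (E n U -> R) -> Prop with
  | 0 => fun=> True
  | m.+1 => fun F => forall y : E m U,
      linear (fun u : 'rV[R]_(edim (E m U)) => F (epair y u))
  end.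

Record cubical_on n U (F : E n U -> R) : Prop := CubicalOn {
  cubical_adj : forall (i j : 'I_n) z, j = i.+1 :> nat -> F (eadj n i U z) = - F z;
  cubical_lin : fiber_linear F }.

Section CubicalForm.
Variables (n : nat) (U : eucl R) (F : E n U -> R).
Hypothesis cF : cubical_on F.

Lemma cubical_tperm (i j : 'I_n) z : i != j -> F (eact (tperm i j) z) = - F z.
Proof.
wlog ij : i j z / (i < j)%N => [H|_].
  rewrite neq_ltn => /orP[ij|ji]; first by apply: H; rewrite ?neq_ltn ij.
  by rewrite tpermC; apply: H; rewrite ?neq_ltn ji.
have [d jd] : exists d, j = (i + d).+1 :> nat.
  by exists (j - i.+1)%N; rewrite -addSn subnKC.
elim: d j z {ij} jd => [|d IH] j z jd.
  have ij : j = i.+1 :> nat by rewrite jd addn0.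
  by rewrite -(eact_eadj _ ij) (cubical_adj cF _ ij).
have kn : (i + d.+1 < n)%N by apply: leq_ltn_trans _ (ltn_ord j); rewrite jd.
pose k := Ordinal kn.
have kj : j = k.+1 :> nat by [].
have ki : k != i by rewrite -val_eqE neq_ltn /= addnS ltnS leq_addr orbT.
have ji : j != i by rewrite -val_eqE /= jd neq_ltn ltnS leq_addr orbT.
(* With [k] just before [j], conjugation by the adjacent [tperm k j] reduces the distance by one;
   three sign changes amount to one. *)
have -> : tperm i j = (tperm k j * tperm i k * tperm k j)%g.
  by rewrite -{1}(tpermV k j) -mulgA -/(conjg _ _) tpermJ tpermL tpermD.
rewrite !eactM -(eact_eadj _ kj) (cubical_adj cF _ kj).
by rewrite (IH k) /= ?addnS// -(eact_eadj _ kj) (cubical_adj cF _ kj) opprK.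
Qed.

Lemma epointM (s : 'S_n) (a : {set 'I_n} -> 'rV[R]_(edim U)) x :
  epoint (fun S => a (s @^-1: S)) x = eact s (epoint a x).
Proof.
apply: tcomp_val_inj => S; rewrite tcomp_eact !tcomp_epoint.
have -> // : (s @^-1: S == finset.set0) = (S == finset.set0).
apply/eqP/eqP => [sS|->]; last exact: preimset0.
by apply/setP => i; have /setP/(_ (s^-1%g i)) := sS; rewrite !inE permKV.
Qed.

Lemma epoint_alt (i j : 'I_n) (a : {set 'I_n} -> 'rV[R]_(edim U)) x : i != j ->
  F (epoint (fun S => a (tperm i j @^-1: S)) x) = - F (epoint a x).
Proof. by move=> ij; rewrite epointM cubical_tperm. Qed.

Lemma epoint_ext (a a' : {set 'I_n} -> 'rV[R]_(edim U)) x :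
  (forall S, S != finset.set0 -> a S = a' S) -> F (epoint a x) = F (epoint a' x).
Proof.
move=> aa'; congr F; apply: tcomp_val_inj => S; rewrite !tcomp_epoint.
by case: eqP => // /eqP; exact: aa'.
Qed.
End CubicalForm.

Lemma epoint_lin0 n U (F : E n.+1 U -> R) c (a a1 a2 : {set 'I_n.+1} -> 'rV[R]_(edim U)) x :
  cubical_on F ->
  (forall S : {set 'I_n.+1}, ord0 \in S -> a S = c *: a1 S + a2 S) ->
  (forall S : {set 'I_n.+1}, ord0 \notin S -> a1 S = a S /\ a2 S = a S) ->
  F (epoint a x) = c * F (epoint a1 x) + F (epoint a2 x).
Proof.
move=> cF aS aN; have /(_ (epoint (a \o scons false) x)) L := cubical_lin cF.
(* Writing [a1] and [a2] as equal to [a] on the sets avoiding [ord0] shows that the three points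
   have the same base in T^n U, so that only the fiber vector varies. *)
have -> : a1 = fun S : {set 'I_n.+1} => if ord0 \in S then a1 S else a S.
  by apply/funext => S; case: ifPn => // /aN[].
have -> : a2 = fun S : {set 'I_n.+1} => if ord0 \in S then a2 S else a S.
  by apply/funext => S; case: ifPn => // /aN[].
have A (b : {set 'I_n.+1} -> 'rV[R]_(edim U)) :
    epoint (fun S : {set 'I_n.+1} => if ord0 \in S then b S else a S) x =
    epair (epoint (a \o scons false) x) (untcomp (b \o scons true)).
  rewrite /=; congr (epair (epoint _ x) (untcomp _)); apply/funext => S /=;
    by rewrite ord0_scons.
rewrite !A.
have {1}-> : a = fun S : {set 'I_n.+1} => if ord0 \in S then a S else a S.
  by apply/funext => S; case: ifP.
rewrite A -L; congr (F (epair _ _)); rewrite -untcomp_linear; congr untcomp.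
by apply/funext => S; exact/aS/ord0_scons.
Qed.

(** Exchanging [i] with 0 changes every term by the same sign and reduces to linearity at index
    0. *)
Lemma epoint_lin n U (F : E n U -> R) (i : 'I_n) c
    (a a1 a2 : {set 'I_n} -> 'rV[R]_(edim U)) x :
  cubical_on F ->
  (forall S : {set 'I_n}, i \in S -> a S = c *: a1 S + a2 S) ->
  (forall S : {set 'I_n}, i \notin S -> a1 S = a S /\ a2 S = a S) ->
  F (epoint a x) = c * F (epoint a1 x) + F (epoint a2 x).
Proof.
case: n F i a a1 a2 => [|n] F i a a1 a2 cF aS aN; first by have := ltn_ord i.
have [i0|i0] := eqVneq i ord0; first by rewrite i0 in aS aN; exact: epoint_lin0.
have alt b : F (epoint b x) = - F (epoint (fun S => b (tperm i ord0 @^-1: S)) x).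
  by rewrite (epoint_alt cF)// opprK.
rewrite (alt a) (alt a1) (alt a2) mulrN -opprD; congr (- _); apply: epoint_lin0 => // S S0.
  by apply: aS; rewrite inE tpermL.
by apply: aN; rewrite inE tpermL.
Qed.

Lemma cubical_on_singletons n U (F : E n U -> R) (z : E n U) : cubical_on F ->
  F z = F (epoint (on_singletons (fun i => tcomp [set i] (\val z))) (ebasen n U z)).
Proof.
move=> cF; rewrite -{1}[z]epointE.
apply: (@multilinear_singletons _ _ _ (fun a => F (epoint a (ebasen n U z)))).
- by move=> a a' aa'; exact: epoint_ext.
- by move=> i c a a1 a2 aS aN; exact: epoint_lin aS aN.
- by move=> i j a ij; exact: epoint_alt.
Qed.

Lemma cubical_form n U (F : E n U -> R) : smooth F -> cubical_on F ->
  is_form (fun x v => F (epoint (on_singletons v) x)).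
Proof.
move=> sF cF; split=> [v|x v i a v1 v2|x v i j ij vij].
- exact: (smooth_comp (smap_smooth (epoint (on_singletons v))) sF).
- apply: (epoint_lin (i := i)) => // S iS.
    case: (pickP (fun j => S == [set j])) => [j /eqP Sj|S1].
      move: iS; rewrite Sj inE => /eqP ->; rewrite !on_singletons1 /=.
      by rewrite eqxx.
    by rewrite !on_singletons0 ?scaler0 ?addr0// => j; rewrite S1.
  have H u : on_singletons [eta v with i |-> u] S =
      on_singletons [eta v with i |-> a *: v1 + v2] S.
    apply: eq_bigr => j /eqP Sj /=; case: eqP => // ji.
    by rewrite Sj ji inE eqxx in iS.
  by rewrite !H.
(* Since [v i = v j], the family on singletons is invariant under the transposition of [i] and [j],
   so the value of [F] equals its opposite. *)
- apply/eqP; rewrite -[_ == 0](mulrn_eq0 _ 2) mulr2n.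
  rewrite -{1}(opprK (F _)) -(epoint_alt cF _ _ ij) addrC subr_eq0; apply/eqP.
  congr (F (epoint _ x)); apply/funext => S.
  rewrite /on_singletons [RHS](reindex_inj (@perm_inj _ (tperm i j))) /=.
  apply: eq_big => k.
    apply/eqP/eqP => [->|kS]; apply/setP => l.
      by rewrite !inE -(inj_eq (@perm_inj _ (tperm i j))) !tpermK.
    by have /setP/(_ (tperm i j l)) := kS; rewrite !inE tpermK (inj_eq perm_inj).
  by case: tpermP => // ->.
Qed.

End Forms.

(** * From differential forms on U to cubical forms *)

Section FormCubical.
Variable R : realType.
Implicit Types (U V W : eucl R).
Notation E n := (eword R (nseq n Tan)).

(** Polarization: the value with [v i + v j] in both slots is zero, and is expanded by
    bilinearity. *)
Lemma form_antisymmetric n U (w : U -> ('I_n -> 'rV[R]_(edim U)) -> R) x v i j :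
  is_form w -> i != j -> w x (v \o tperm i j) = - w x v.
Proof.
move=> [_ wL wA] ij; have ji : j == i = false by rewrite eq_sym (negbTE ij).
pose W p q := w x [eta [eta v with i |-> p] with j |-> q].
have Wd p : W p p = 0 by apply: (wA _ _ i j) => //=; rewrite (negbTE ij) !eqxx.
have WC p q : [eta [eta v with i |-> p] with j |-> q] =
    [eta [eta v with j |-> q] with i |-> p] :> ('I_n -> 'rV[R]_(edim U)).
  by apply/funext => k /=; case: (eqVneq k j) => // ->; rewrite ji.
have Wr p q q' : W p (q + q') = W p q + W p q'.
  by have := wL x [eta v with i |-> p] j 1 q q'; rewrite scale1r mul1r.
have Wl p p' q : W (p + p') q = W p q + W p' q.
  by have := wL x [eta v with j |-> q] i 1 p p'; rewrite scale1r mul1r /W !WC.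
have E1 : W (v i) (v j) = w x v.
  by congr (w x); apply/funext => k /=; do 2?case: eqP => [->|_].
have -> : w x (v \o tperm i j) = W (v j) (v i).
  congr (w x); apply/funext => k /=.
  by case: tpermP => [->|->|/eqP/negbTE-> /eqP/negbTE->]; rewrite ?(negbTE ij) ?eqxx.
have := Wd (v i + v j); rewrite Wl !Wr !Wd addr0 add0r E1 addrC => /eqP.
by rewrite addr_eq0 => /eqP.
Qed.

(** [is_form] gives smoothness for constant vectors; variable vectors are expanded in coordinates,
    one slot at a time, by multilinearity. *)
Lemma smooth_form n U V (w : U -> ('I_n -> 'rV[R]_(edim U)) -> R) (b : smap V U)
    (g : 'I_n -> V -> 'rV[R]_(edim U)) :
  is_form w -> (forall i k, smooth (fun z => g i z 0 k)) ->
  smooth (fun z => w (b z) (fun i => g i z)).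
Proof.
move=> [wS wL _] gS.
suff K (s : seq 'I_n) (u : 'I_n -> 'rV[R]_(edim U)) :
    smooth (fun z => w (b z) (fun i => if i \in s then g i z else u i)).
  have := K (enum 'I_n) (fun=> 0).
  have -> // : (fun z => w (b z) (fun i => if i \in enum 'I_n then g i z else 0)) =
               fun z => w (b z) (fun i => g i z).
  by apply/funext => z; congr (w _); apply/funext => i; rewrite mem_enum.
elim: s u => [|i s IH] u.
  exact: (smooth_comp (smap_smooth b) (wS u)).
have [is_|is_] := boolP (i \in s).
  have -> // : (fun z => w (b z) (fun j => if j \in i :: s then g j z else u j)) =
            fun z => w (b z) (fun j => if j \in s then g j z else u j).
  apply/funext => z; congr (w _); apply/funext => j; rewrite inE.
  by case: eqP => // ->; rewrite is_.
have -> : (fun z => w (b z) (fun j => if j \in i :: s then g j z else u j)) =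
    fun z => \sum_k (g i z 0 k * w (b z) (fun j => if j \in s then g j z
      else [eta u with i |-> delta_mx 0 k] j)).
  apply/funext => z.
  have L0 : linear (fun q => w (b z) [eta (fun j => if j \in s then g j z else u j) with i |-> q]).
    by move=> a p q; exact: wL.
  pose L : {linear 'rV[R]_(edim U) -> R} := HB.pack (fun q => w (b z) _)
    (GRing.isLinear.Build _ _ _ _ _ L0).
  transitivity (L (g i z)).
    congr (w _); apply/funext => j /=; rewrite inE.
    by case: eqP => // ->.
  rewrite {1}(row_sum_delta (g i z)) linear_sum; apply: eq_bigr => k _.
  rewrite linearZ; congr (_ * _); apply: (congr1 (w (b z))); apply/funext => j /=.
  by case: (eqVneq j i) => // ->; rewrite (negbTE is_).
by apply: smooth_sum => k; apply: smoothM.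
Qed.

Definition form_cube n U (w : U -> ('I_n -> 'rV[R]_(edim U)) -> R) (z : E n U) : R :=
  w (ebasen n U z) (fun i => tcomp [set i] (\val z)).

Lemma smooth_form_cube n U w : is_form w -> smooth (@form_cube n U w).
Proof.
move=> wF; apply: (smooth_form (ebasen n U)
  (g := fun i (z : E n U) => tcomp [set i] (\val z))) => // i k.
have -> : (fun z : E n U => tcomp [set i] (\val z) 0 k) =
  fun z => \sum_j (tcomp [set i] (delta_mx 0 j) 0 k * (\val z) 0 j).
  apply/funext => z; rewrite {1}(row_sum_delta (\val z)) linear_sum summxE.
  by apply: eq_bigr => j _; rewrite linearZ mxE mulrC.
apply: smooth_sum => j; apply: smoothM; first exact: smooth_cst.
exact: smooth_proj.
Qed.

Lemma form_cube_cubical n U w : is_form w -> cubical_on (@form_cube n U w).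
Proof.
move=> wF; split=> [i j z ij|].
  rewrite (eact_eadj _ ij) /form_cube.
  have -> : ebasen n U (eact (tperm i j) z) = ebasen n U z by exact: ebasen_epoint.
  have ij' : i != j by rewrite -val_eqE /= ij neq_ltn ltnSn.
  rewrite -(form_antisymmetric _ _ wF ij'); congr (w _); apply/funext => k.
  rewrite tcomp_eact /=; congr (tcomp _ _); apply/setP => l.
  by rewrite !inE (canF_eq (tpermK i j)).
case: n w wF => [//|n] w [_ wL _] y c u1 u2.
(* The fiber vector [u] enters only through the component at {0}, which is the base part of [u]; the
   other singletons come from [y]. *)
have A u : form_cube w (epair y u) = w (ebasen n U y)
    [eta (fun i => tcomp [set i] (\val (epair y 0))) with ord0 |-> tcomp finset.set0 u].
  rewrite /form_cube /= ebase_pair; congr (w _); apply/funext => i /=.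
  rewrite !row_mxKl !row_mxKr inE; case: eqVneq => [<-|//] /=.
  by rewrite stail1.
by rewrite !A linearP wL.
Qed.
End FormCubical.

(** * The isomorphism on an elastic space *)

Section Main.
Variables (R : realType) (X : dflg R).
Hypothesis hX : elastic X.
Notation E n := (eword R (nseq n Tan)).

Lemma teta_tliftE n (h : hom (Tpow n.+1 X) (Rline R)) U (p : plots X U) (z : E n.+1 U) :
  teta R (lmap (etan R) h (tlift (Tpow n X) (Tplot n.+1 p z))) =
  pd (h \o Tplot n.+1 p) (epair (ebase z) 0) (row_mx 0 (efib z)).
Proof.
have -> : tlift (Tpow n X) (Tplot n.+1 p z) =
    tplot (Tplot n.+1 p) (elift (E n U) z).
  exact: (lrecE (@tlift_comp _ (Tpow n X))
    (fun V q => is_plot_comp (elift V) (plotP (tplot (tplot q))))).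
apply: etrans (tetaE h (Tplot n.+1 p) (elift (E n U) z)) _.
by rewrite ebase_pair efib_pair.
Qed.

(** The lift condition equates [h] on a fiber with its derivative at the zero vector, and a
    derivative is linear in its direction. *)
Lemma cubical_axioms_plot n (h : hom (Tpow n X) (Rline R)) U (p : plots X U) :
  cubical_axioms h -> cubical_on (h \o Tplot n p).
Proof.
case: n h => [|n] h; first by move=> _; split=> // -[].
move=> [hA hL]; split=> [i j z ij|y a u v].
  have /hA/(_ (Tplot n.+1 p z)) := tperm_actM ij (tperm_act1 n.+1 X).
  rewrite mul1g odd_tperm.
  have -> : i != j by rewrite -val_eqE /= ij neq_ltn ltnSn.
  by rewrite expr1 mulN1r -[h (hcomp _ _ _)]/(h (tadj n.+1 i X (Tplot n.+1 p z))) tadjE.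
have sh : smooth (h \o Tplot n.+1 p) := hom_plot h (plotP (Tplot n.+1 p)).
have A w : (h \o Tplot n.+1 p) (epair y w) =
    pd (h \o Tplot n.+1 p) (epair y 0) (row_mx 0 w).
  have := hL (Tplot n.+1 p (epair y w)).
  by rewrite teta_tliftE ebase_pair efib_pair => ->.
rewrite !A -(pd_linear _ sh); congr pd.
by rewrite scale_row_mx add_row_mx scaler0 addr0.
Qed.

Definition cub_to_dR n (w : Tpow n X -> R) (r : dR_arg n X) : R :=
  w (Tplot n (argp r) (epoint (on_singletons (argv r)) (argx r))).

Lemma cub_to_dRP n (w : Omega_cub n X) : cub_to_dR w \in @dR_pred R n X.
Proof.
have /asboolP[h hw hc] := cub_funP w; rewrite -hw; apply/asboolP.
have sF U (p : plots X U) : smooth (h \o Tplot n p) := hom_plot h (plotP (Tplot n p)).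
split=> [U p|U V p f x v].
  exact: (cubical_form (sF U p) (cubical_axioms_plot p hc)).
rewrite /cub_to_dR /= Tplot_compE.
(* T^n f can create components at larger sets, from higher derivatives of [f]; they are discarded
   here, and [tcomp1_nat] computes the rest. *)
apply: etrans (cubical_on_singletons _ (cubical_axioms_plot p hc)) _ => /=.
rewrite ebasen_nat ebasen_epoint.
have -> // : (fun i => tcomp [set i] (\val (emap (E n) f (epoint (on_singletons v) x)))) =
   fun i => dmap f x (v i).
apply/funext => i; rewrite tcomp1_nat ebasen_epoint tcomp_epoint.
rewrite on_singletons1 ifF//; apply/negbTE/set0Pn; exists i; exact: set11.
Qed.

Definition cub_dR n (w : Omega_cub n X) : Omega_dR n X := OmegaDR (cub_to_dRP w).

Lemma cub_dR_linear n : linear (@cub_dR n).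
Proof. by move=> a u v; apply: val_inj. Qed.

(** The maps T^n p are jointly surjective, and on T^n U the cubical form is recovered from the de
    Rham form by [cubical_on_singletons]. *)
Lemma cub_dR_inj n : injective (@cub_dR n).
Proof.
move=> u v uv; apply: val_inj; apply/funext => a.
have [U [p [z <-]]] := Tplot_onto hX a.
have H (w : Omega_cub n X) : w (Tplot n p z) =
    cub_dR w (DRArg p (ebasen n U z) (fun i => tcomp [set i] (\val z))).
  have /asboolP[h hw hc] := cub_funP w; rewrite /= -hw.
  exact: (cubical_on_singletons z (cubical_axioms_plot p hc)).
by rewrite -[\val u]/(cub_fun u) -[\val v]/(cub_fun v) !H uv.
Qed.

(** The functions [form_cube] are compatible with changes of plot, by [ebasen_nat] and [tcomp1_nat],
    and glue on the colimit T^n X. *)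
Lemma cub_dR_surj n (w : Omega_dR n X) : exists v, cub_dR v = w.
Proof.
have /asboolP[wF wP] := dR_funP w.
pose wp U (p : plots X U) := fun x v => w (DRArg p x v).
have wpF U (p : plots X U) : is_form (wp U p) by exact: wF.
have [U V p f z|U p|h hE] := @Tpow_rec R X hX n (Rline R)
    (fun U p => form_cube (wp U p)).
- rewrite /form_cube /wp wP ebasen_nat; congr (w (DRArg _ _ _)); apply/funext => i.
  by rewrite tcomp1_nat.
- exact: (smooth_form_cube (wF U p)).
have hF U (p : plots X U) : h \o Tplot n p = form_cube (wp U p).
  by apply/funext => z; exact: hE.
have hc : cubical_axioms h.
  (* The sign rule is checked along a word in adjacent transpositions, the lift condition through
     [pd_vertical], both on plots. *)
  case: n w wF wP wp wpF h hE hF => [//|n] w wF wP wp wpF h hE hF; split=> [s f sf a|a].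
    elim: sf a => [|i j s' f' ij _ IH] a; first by rewrite odd_perm1 mul1r.
    have neg b : h (tadj n.+1 i X b) = - h b.
      have [U [p [z <-]]] := Tplot_onto hX b.
      rewrite tadjE// !hE; exact: (cubical_adj (form_cube_cubical (wpF U p)) z ij).
    rewrite /= neg IH odd_permM odd_tperm.
    have -> : i != j by rewrite -val_eqE /= ij neq_ltn ltnSn.
    by rewrite signr_addb expr1 mulrN1 mulNr.
  have [U [p [z <-]]] := @Tplot_onto R X hX n.+1 a; rewrite teta_tliftE hF.
  rewrite (pd_vertical _ (smooth_form_cube (wpF U p))).
    by rewrite epairE -hF.
  exact: (cubical_lin (form_cube_cubical (wpF U p)) (ebase z)).
have hp : (h : Tpow n X -> R) \in @cubical_pred R n X by apply/asboolP; exists h.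
exists (OmegaCub hp); apply: val_inj; apply/funext => -[U p x v].
rewrite /= /cub_to_dR /= hE /form_cube /wp ebasen_epoint.
congr (w (DRArg _ _ _)); apply/funext => i.
rewrite tcomp_epoint on_singletons1 ifF//; apply/negbTE/set0Pn; exists i; exact: set11.
Qed.
End Main.

Theorem proposition6p4 (R : realType) (X : dflg R) (hX : elastic X) (n : nat) :
  exists Phi : {linear Omega_cub n X -> Omega_dR n X}, bijective Phi.
Proof.
pose Phi : {linear Omega_cub n X -> Omega_dR n X} := HB.pack (@cub_dR R X hX n)
  (GRing.isLinear.Build _ _ _ _ _ (@cub_dR_linear R X hX n)).
(* A right inverse chosen by surjectivity is two-sided by injectivity. *)
exists Phi; pose g (w : Omega_dR n X) := projT1 (cid (cub_dR_surj hX w)).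
have gK : cancel g Phi by move=> w; exact: projT2 (cid (cub_dR_surj hX w)).
by exists g => // w; apply: (@cub_dR_inj R X hX n); exact: gK.
Qed.
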